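(* Let $k\ge3$ and $d\ge2k+3$ be integers. Let $\frac{d+1}{d-1}<p_1<2<p_2\le\cdots\le p_k$ be such that $\sum_{i=1}^k p_i^{-1}=1$, and let $j$ be the largest index $i\le k-1$ for which $p_i<\frac12(d+1)$. Then for all positive integers $\lambda$ and all functions $f_1,\dots,f_k$ on $\mathbb{Z}^d$, $$\|T_{\rm sim}(f_1,\dots,f_k)\|_1\lesssim \lambda^{\frac{k(k-1)-dj}{2}+\frac{d}{p_1'}+\sum_{1<i\le j}\frac{d}{p_i}}\,\|f_1\|_{p_1}\prod_{i=2}^k\|f_i\|_{p_i'}.$$ Moreover, if $j=k-1$ and $\frac{d+3}{d+1}<2p_1^{-1}+p_k^{-1}<\frac32$, then $$\|T_{\rm sim}(f_1,\dots,f_k)\|_1\lesssim \lambda^{\frac{k(k-1)-d(k-2)}{2}}\,\|f_1\|_{p_1}\prod_{i=2}^k\|f_i\|_{p_i'}.$$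
   Context: $\|\cdot\|_p$ is the norm of $\ell^p(\mathbb{Z}^d)$, $p'=p/(p-1)$ is the conjugate exponent, and $|\cdot|$ is the Euclidean norm. The discrete simplex averaging operator (at parameter $\lambda$) is $$T_{\rm sim}(f_1,\dots,f_k)(x)=\frac{1}{\lambda^{\frac{dk-k(k+1)}{2}}}\sum_{(u_1,\dots,u_k)\in\mathcal W_\lambda}\ \prod_{i=1}^k f_i(x-u_i),$$ where $$\mathcal W_\lambda=\{(u_1,\dots,u_k)\in(\mathbb{Z}^d)^k: |u_i|^2=|u_i-u_j|^2=\lambda\text{ for all } i\ne j\}.$$ $X\lesssim Y$ means $X\le CY$ with $C$ depending only on $d,k$ and the $p_i$ (not on $\lambda$ or the $f_i$). *)

(* Defs.v *)
From HB Require Import structures.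
From mathcomp Require Import all_boot all_order all_algebra.
From mathcomp Require Import all_classical all_reals all_analysis.
From mathcomp Require Import complex.

Set Implicit Arguments.
Unset Strict Implicit.
Unset Printing Implicit Defensive.

Import Order.TTheory GRing.Theory Num.Theory.

Local Open Scope classical_set_scope.
Local Open Scope ring_scope.

(* Z^d, as an alias so that it can carry the discrete sigma-algebra; its
   l^p norms are then the L^p norms of the counting measure. *)
Definition lattice (d : nat) : Type := 'rV[int]_d.

HB.instance Definition _ d := GRing.Zmodule.on (lattice d).
HB.instance Definition _ d := @isPointed.Build (lattice d) 0.
HB.instance Definition _ d := @isMeasurable.Build default_measure_display
  (lattice d) discrete_measurable discrete_measurable0
  discrete_measurableC discrete_measurableU.

(* Extended-real valued: it is +oo when f is not in l^p. *)
Definition lpnorm (R : realType) d (p : R) (f : lattice d -> R[i]) : \bar R :=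
  Lnorm (counting : {measure set (lattice d) -> \bar R}) p%:E
    (fun x => (ComplexField.Normc.normc (f x))%:E).

(* Agrees with hoelder_conjugate for 1 < p, but takes values in R, so that it
   can be used in real exponents. *)
Definition conj_exp (R : realType) (p : R) : R := p / (p - 1).

Definition normsq d (v : lattice d) : int := \sum_(c < d) v 0 c ^+ 2.

(* The set W_lam; the tuple (u_1, ..., u_k) is the matrix with rows u_i. *)
Definition simplices (d k lam : nat) : set 'M[int]_(k, d) :=
  [set u | (forall i, normsq (row i u) = lam%:Z) /\
           (forall i j, i != j -> normsq (row i u - row j u) = lam%:Z)].
Arguments simplices : clear implicits.

Lemma finite_simplices (d k lam : nat) : finite_set (simplices d k lam).
Proof.
pose g (h : {ffun 'I_k * 'I_d -> 'I_(lam.*2.+1)}) : 'M[int]_(k, d) :=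
  \matrix_(i, c) ((h (i, c))%:Z - lam%:Z).
apply: (@sub_finite_set _ _ (range g)); last first.
  exact/finite_image/finite_finset.
move=> u [uW _].
have ule i c : `|u i c| <= lam%:Z.
  have ui2 : `|u i c| ^+ 2 <= lam%:Z.
    rewrite real_normK ?num_real// -(uW i) /normsq (bigD1 c)//= mxE.
    by rewrite lerDl sumr_ge0// => c' _; exact: sqr_ge0.
  apply: le_trans ui2; case: (u i c) => n /=; rewrite -?PoszM.
    by rewrite expr2 -PoszM lez_nat; case: n => // n; rewrite leq_pmull.
  by rewrite expr2 -PoszM lez_nat leq_pmull.
have ubd i c : (`|(u i c + lam%:Z)%R| < lam.*2.+1)%N.
  have := ule i c; rewrite ler_norml => /andP[l1 l2].
  rewrite ltnS -lez_nat gez0_abs; last by rewrite -lerBlDr sub0r.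
  by rewrite -addnn PoszD lerD2r.
exists [ffun ic => Ordinal (ubd ic.1 ic.2)] => //.
apply/matrixP => i c; rewrite mxE ffunE /= gez0_abs ?addrK//.
have := ule i c; rewrite ler_norml => /andP[l1 l2].
by rewrite -lerBlDr sub0r.
Qed.

(* The functions f_1, ..., f_k are the values at 1, ..., k of f. *)
Definition Tsim (R : realType) (d k lam : nat) (f : nat -> lattice d -> R[i])
    (x : lattice d) : R[i] :=
  ((lam%:R `^ (((d * k)%:R - (k * (k + 1))%:R) / 2))^-1)%:C%C *
  \sum_(u \in simplices d k lam) \prod_(i < k) f i.+1 (x - row i u).

(* Main.v *)
Require Import Defs.
From HB Require Import structures.
From mathcomp Require Import all_boot all_order all_algebra.
From mathcomp Require Import algC cyclotomic.
From mathcomp Require Import all_classical all_reals all_analysis.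
From mathcomp Require Import complex.
From mathcomp Require Import ring lra zify.

(** Drop the conditions |u_i - u_j|^2 = lam. The sum over simplices is then
bounded by a product of sums over the sphere |u|^2 = lam, and comparing the
normalizations this costs exactly the factor lam^(k(k-1)/2) of both estimates.
With U_f(x) the sum of f(x - u) over the sphere, what has to be shown is
<<
   sum_x  U_(f_1)(x) ... U_(f_k)(x)  <=  C lam^e |f_1|_(q_1) ... |f_k|_(q_k).
>>

Take indicator functions of finite sets F_i first, of sizes n_i, and look at a set
of g points x on which U_(F_i) is about tau_i for every i. Let r be the number
of points of the sphere. Trivially tau_i <= r, tau_i <= n_i and
tau_i g <= r n_i. The only arithmetic information is a fourth bound,
<<
   tau_i g  <=  C lam^(1+eps) (g n_i)^(1-2/d)
>>
([incidence_le]). For each i any weighted geometric mean of the four bounds may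
be used; in the (1/p, 1/q)-plane this is interpolation between the mapping
properties l^oo -> l^oo, l^1 -> l^oo, l^1 -> l^1 and an l^p-improving
estimate at the vertex (1 - 2/d, 2/d). The product of the tau_i times g is
then under control as soon as the means contain altogether a factor 1/g, which is
Hoelder's condition ([restricted_bound]). There are only logarithmically many
dyadic levels, and the exponents in the theorem satisfy strict inequalities, so
that logarithms and small powers of lam are harmless. For the same reason a bound
on indicators implies one on functions: the norms of l^p(Z^d) decrease with p,
and a bound with a slightly smaller power of each n_i can be summed over
dyadic layers ([restricted_to_strong]).

The fourth bound is an elementary form of the circle method. Detect
|x - y|^2 = lam by averaging e(a (|x - y|^2 - lam) / M) over a modulo M. For
fixed a, the bilinear form between the sets is trivially at most g n; composing
the operator with its adjoint, it is also at most (g n s_a^d)^(1/2), where s_a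
is a sum of one-dimensional geometric sums. Hence it is at most
(g n)^(1-2/d) s_a^2, and the mean of s_a^2 over a decides. Geometric sums are
majorized by sums of Fejer kernels ([norm_geom_fejer]), which are nonnegative, and so this
mean is bounded by a number of solutions of h n + h' n' = h m + h' m', of size
lam up to logarithms ([weyl_majorant_moment]). The bound lam^(d/2 - 1 + eps)
for r follows by counting incidences between two boxes ([size_sphere_le]).

It remains to choose the interpolation parameters. The first estimate of the
theorem already follows from the three trivial bounds ([Tsim_bound_corners]), the
second one also uses the fourth ([Tsim_bound_improving]). *)

Set Implicit Arguments.
Unset Strict Implicit.
Unset Printing Implicit Defensive.

Import Order.TTheory GRing.Theory Num.Theory.

Local Open Scope ring_scope.

(** * Geometric sums and Fejer kernels *)

Definition geom (C : pzRingType) (w : C) (m : nat) : C := \sum_(i < m) w ^+ i.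

(** The Fejer kernel of order 2^j at the point w of the unit circle: as a
function of w it is a nonnegative trigonometric polynomial with coefficients
in [0, 1], which is what makes its moments countable. *)
Definition fejer (C : numClosedFieldType) (w : C) (j : nat) : C :=
  `|geom w (2 ^ j)| ^+ 2 / (2 ^ j)%:R.

Lemma fejer_ge0 (C : numClosedFieldType) (w : C) j : 0 <= fejer w j.
Proof. by rewrite divr_ge0 ?exprn_ge0. Qed.

Lemma norm_geom_le (C : numClosedFieldType) (w : C) m :
  `|w| = 1 -> `|geom w m| <= m%:R.
Proof.
move=> w1; apply: le_trans (ler_norm_sum _ _ _) _.
under eq_bigr do rewrite normrX w1 expr1n.
by rewrite sumr_const card_ord.
Qed.

Lemma norm_geom_le2 (C : numClosedFieldType) (w : C) m :
  `|w| = 1 -> `|w - 1| * `|geom w m| <= 2.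
Proof.
move=> w1; rewrite -normrM -subrX1; apply: le_trans (ler_normB _ _) _.
by rewrite normrX w1 expr1n normr1.
Qed.

Lemma norm_geom_sub (C : numClosedFieldType) (w : C) m :
  `|w| = 1 -> `|geom w m - m%:R| <= `|w - 1| * (m ^ 2)%:R.
Proof.
move=> w1; rewrite /geom -[m in m%:R]card_ord -sumr_const -sumrB.
apply: le_trans (ler_norm_sum _ _ _) _.
have le_i (i : 'I_m) : true -> `|w ^+ i - 1| <= `|w - 1| * m%:R.
  move=> _; rewrite subrX1 normrM ler_wpM2l//.
  by apply: le_trans (norm_geom_le _ w1) _; rewrite ler_nat ltnW.
apply: le_trans (ler_sum _ le_i) _.
by rewrite sumr_const card_ord -mulrnAr -mulrnA mulnn.
Qed.

(** A sum of l terms is bounded by min(l, 2/|w - 1|). The order m = 2^j that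
matters is the one just before the first failure of |geom w m| >= m/2: then the
Fejer kernel is at least m/4, and the failure at 2 m forces |w - 1| to be at
least 1/(4 m), so that the left-hand side is at most 8 m. *)
Lemma norm_geom_fejer (C : numClosedFieldType) (w : C) J l :
  `|w| = 1 -> (l < 2 ^ J.+1)%N ->
  `|geom w l| <= 32 * \sum_(j < J.+1) fejer w j.
Proof.
move=> w1 lJ.
have single (j : nat) (x : C) : (j < J.+1)%N -> x <= 32 * fejer w j ->
    x <= 32 * \sum_(j < J.+1) fejer w j.
  move=> jJ /le_trans; apply; rewrite ler_wpM2l//.
  rewrite (bigD1 (Ordinal jJ))//= lerDl sumr_ge0// => i _; exact: fejer_ge0.
have fejer_big j : (2 ^ j)%:R <= 2 * `|geom w (2 ^ j)| ->
    (2 ^ j)%:R <= 4 * fejer w j.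
  move=> big; have p0 : 0 < (2 ^ j)%:R :> C by rewrite ltr0n expn_gt0.
  rewrite /fejer mulrA ler_pdivlMr// -expr2.
  have -> : 4 * `|geom w (2 ^ j)| ^+ 2 = (2 * `|geom w (2 ^ j)|) ^+ 2 by ring.
  by rewrite lerXn2r ?nnegrE ?mulr_ge0.
have [/existsP[/= j0 Pj0]|/existsPn /= all_big] := boolP
    [exists j : 'I_J.+1, 2 * `|geom w (2 ^ j)| < (2 ^ j)%:R]; last first.
  have big : (2 ^ J)%:R <= 2 * `|geom w (2 ^ J)|.
    by have := all_big ord_max; rewrite -real_leNgt ?ger0_real// mulr_ge0.
  apply: (single J) => //; apply: le_trans (norm_geom_le _ w1) _.
  have : (l%:R : C) <= 8 * (2 ^ J)%:R.
    rewrite -natrM ler_nat; apply: leq_trans (ltnW lJ) _.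
    by rewrite expnS leq_mul2r orbT.
  move=> /le_trans; apply; rewrite (_ : 32 = 8 * 4) -?mulrA; last by ring.
  by rewrite ler_wpM2l// fejer_big.
have exP : exists j, (j < J.+1)%N && (2 * `|geom w (2 ^ j)| < (2 ^ j)%:R).
  by exists j0; rewrite ltn_ord.
case: (ex_minnP exP) => -[|j] /andP[jJ small] minj.
  by move: small; rewrite /geom big_ord1 expr0 normr1 mulr1 (ltr_nat _ 2 1).
have jJ' : (j < J.+1)%N by apply: ltn_trans jJ.
have big : (2 ^ j)%:R <= 2 * `|geom w (2 ^ j)|.
  rewrite real_leNgt ?ger0_real ?mulr_ge0//; apply/negP => sm.
  by have := minj j; rewrite jJ' sm ltnn => /(_ isT).
have m0 : 0 < (2 ^ j)%:R :> C by rewrite ltr0n expn_gt0.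
set m := (2 ^ j)%:R in m0 *.
(* The failed test at 2m keeps w away from 1. *)
have gap : 1 <= 4 * m * `|w - 1|.
  have := norm_geom_sub (2 ^ j.+1) w1.
  have -> : ((2 ^ j.+1) ^ 2)%:R = 4 * m * m :> C.
    by rewrite -mulnn natrM expnS natrM -/m; ring.
  have lo : m <= `|geom w (2 ^ j.+1) - (2 ^ j.+1)%:R|.
    rewrite distrC; apply: le_trans (lerB_dist _ _).
    have -> : `|(2 ^ j.+1)%:R| = 2 * m :> C by rewrite normr_nat expnS natrM.
    rewrite lerBrDr -(@ler_pM2l _ 2)// mulrDr.
    have -> : 2 * (2 * m) = 2 * m + 2 * m by ring.
    by rewrite lerD2l ltW// /m -natrM -expnS.
  move=> /(le_trans lo); rewrite -(ler_pM2r m0) mul1r => /le_trans; apply.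
  by rewrite le_eqVlt; apply/orP; left; apply/eqP; ring.
apply: (single j) => //.
apply: (@le_trans _ _ (8 * m)).
  rewrite -[leLHS]mul1r; apply: (@le_trans _ _ (4 * m * `|w - 1| * `|geom w l|)).
    by rewrite ler_wpM2r.
  rewrite -mulrA (_ : 8 * m = 4 * m * 2); last by ring.
  by rewrite ler_wpM2l ?norm_geom_le2// mulr_ge0 ?ltW.
rewrite (_ : 32 = 8 * 4) -?mulrA; last by ring.
by rewrite ler_wpM2l// fejer_big.
Qed.

(** * Orthogonality of roots of unity *)

Lemma prim_root_norm1 (C : numClosedFieldType) (z : C) M :
  (0 < M)%N -> M.-primitive_root z -> `|z| = 1.
Proof.
move=> M0 /prim_expr_order zM; apply/eqP.
by rewrite -(@pexpr_eq1 _ `|z| M)// -normrX zM normr1.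
Qed.

Lemma sum_roots (C : numClosedFieldType) (z : C) M s t :
  (0 < M)%N -> M.-primitive_root z -> (s < M)%N -> (t < M)%N ->
  \sum_(a < M) z ^+ (a * s) * (z ^+ (a * t))^* = M%:R * (s == t)%:R.
Proof.
move=> M0 pz sM tM; have z1 := prim_root_norm1 M0 pz.
have zn0 n : z ^+ n != 0 by rewrite -normr_eq0 normrX z1 expr1n oner_eq0.
have conjz n : (z ^+ n)^* = (z ^+ n)^-1.
  by rewrite invC_norm normrX z1 !expr1n invr1 mul1r.
pose w := z ^+ s / z ^+ t.
rewrite (eq_bigr (fun a : 'I_M => w ^+ a)); last first.
  by move=> a _; rewrite conjz /w expr_div_n -!exprM ![(_ * a)%N]mulnC.
have -> : (s == t) = (w == 1).
  rewrite /w -[in RHS](inj_eq (mulIf (zn0 t))) mul1r divfK//.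
  by rewrite (eq_prim_root_expr pz) !modn_small.
have [->|wn1] := eqVneq w 1.
  by rewrite mulr1 (eq_bigr (fun=> 1))=> [|a _]; rewrite ?sumr_const ?card_ord ?expr1n.
rewrite mulr0; apply: (mulfI (_ : w - 1 != 0)); first by rewrite subr_eq0.
rewrite mulr0 -subrX1 /w expr_div_n -!exprM ![(_ * M)%N]mulnC !exprM.
by rewrite (prim_expr_order pz) !expr1n divr1 subrr.
Qed.

Lemma parseval_roots (C : numClosedFieldType) (z : C) M (I : finType)
    (t : I -> nat) :
  (0 < M)%N -> M.-primitive_root z -> (forall i, (t i < M)%N) ->
  \sum_(a < M) `|\sum_(i : I) z ^+ (a * t i)| ^+ 2 =
  M%:R * (\sum_(i : I) \sum_(i' : I) (t i == t i'))%:R.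
Proof.
move=> M0 pz tM; rewrite (eq_bigr _ (fun a _ => normCK _)).
under eq_bigr do rewrite rmorph_sum big_distrl/=.
rewrite exchange_big/= natr_sum mulr_sumr; apply: eq_bigr => i _.
under eq_bigr do rewrite big_distrr/=.
rewrite exchange_big/= natr_sum mulr_sumr; apply: eq_bigr => i' _.
exact: sum_roots.
Qed.

(** * Counting solutions of linear equations *)

Lemma sum_modn_le m e c : (0 < e)%N ->
  (\sum_(i < m) (i == c %[mod e]) <= (m %/ e).+1)%N.
Proof.
move=> e0.
have -> : (\sum_(i < m) (i == c %[mod e]) =
           #|[set i : 'I_m | i == c %[mod e]]|)%N.
  by rewrite -sum1dep_card [RHS]big_mkcond; apply: eq_bigr => i _; case: eqP.
have lt_i (i : 'I_m) : (i %/ e < (m %/ e).+1)%N by rewrite ltnS leq_div2r// ltnW.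
pose f (i : 'I_m) := Ordinal (lt_i i).
rewrite -[X in (_ <= X)%N](card_ord (m %/ e).+1).
apply: (@leq_card_in _ _ f) => i i'; rewrite !inE => /eqP ei /eqP ei' [] ed.
apply: val_inj => /=.
by rewrite (divn_eq i e) (divn_eq i' e) ed ei ei'.
Qed.

(** Fix the first coordinate of i and the second one of i'. The second
coordinate of i is then confined to one residue class modulo h / gcd(h, h'),
and it determines the last unknown. *)
Lemma count_linear_le h h' m m' P :
  (0 < h <= P)%N -> (m' <= P)%N ->
  ((\sum_(i : 'I_m * 'I_m') \sum_(i' : 'I_m * 'I_m')
     ((h * i.1 + h' * i.2) == (h * i'.1 + h' * i'.2)))%N * h <=
   m * m' * (2 * P * gcdn h h'))%N.
Proof.
move=> /andP[h0 hP] mP; set g := gcdn h h'.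
have g0 : (0 < g)%N by rewrite gcdn_gt0 h0.
set e := (h %/ g)%N; have he : h = (e * g)%N by rewrite divnK ?dvdn_gcdl.
have e0 : (0 < e)%N by rewrite divn_gt0// dvdn_leq ?dvdn_gcdl.
rewrite -(pair_bigA _ (fun (i1 : 'I_m) (i2 : 'I_m') => \sum_(i' : 'I_m * 'I_m')
     ((h * i1 + h' * i2)%N == (h * i'.1 + h' * i'.2)%N : nat)))%N/=.
have inner (i1 : 'I_m) (j2 : 'I_m') :
  (\sum_(i2 < m') \sum_(j1 < m)
    ((h * i1 + h' * i2) == (h * j1 + h' * j2)) <= (m' %/ e).+1)%N.
  have [/existsP[/= c /existsP[/= j1c /eqP cP]]|] :=
    boolP [exists i2 : 'I_m', exists j1 : 'I_m,
             (h * i1 + h' * i2 == h * j1 + h' * j2)%N]; last first.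
    move=> /existsPn /= no; rewrite big1// => i2 _; rewrite big1// => j1 _.
    by have /existsPn/(_ j1)/negbTE-> := no i2.
  apply: leq_trans (sum_modn_le m' c e0); apply: leq_sum => i2 _.
  have [/existsP[/= j1 /eqP Ej1]|/existsPn no] := boolP [exists j1 : 'I_m,
             (h * i1 + h' * i2 == h * j1 + h' * j2)%N]; last first.
    by rewrite big1// => j1 _; rewrite (negbTE (no j1)).
  have -> : (i2 == c %[mod e]) = true.
    have : (h * j1c + h' * i2 = h * j1 + h' * c)%N by lia.
    have h'g : h' = ((h' %/ g) * g)%N by rewrite divnK ?dvdn_gcdr.
    rewrite he h'g => E.
    have {}E : (e * j1c + (h' %/ g) * i2 = e * j1 + (h' %/ g) * c)%N.
      apply/eqP; rewrite -(eqn_pmul2r g0) !mulnDl.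
      by rewrite !(mulnAC _ _ g); apply/eqP.
    have co : coprime e (h' %/ g).
      rewrite /coprime -(eqn_pmul2r g0) muln_gcdl -he -h'g mul1n; exact/eqP.
    have E2 : ((h' %/ g) * i2 = (h' %/ g) * c %[mod e])%N.
      by rewrite -(modnMDl j1c ((h' %/ g) * i2)) mulnC E [(e * _)%N]mulnC modnMDl.
    have [le|/ltnW le] := leqP i2 c.
      rewrite eq_sym eqn_mod_dvd// -(Gauss_dvdr _ co) mulnBr -eqn_mod_dvd ?leq_mul//.
      by rewrite eq_sym; apply/eqP.
    rewrite eqn_mod_dvd// -(Gauss_dvdr _ co) mulnBr -eqn_mod_dvd ?leq_mul//.
    by apply/eqP.
  rewrite (bigD1 j1)//= big1 ?addn0 ?Ej1 ?eqxx// => j nj.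
  apply/eqP; rewrite eqb0; apply: contra nj => /eqP Ej.
  apply/eqP/val_inj => /=.
  by move: Ej => /addIn/eqP; rewrite eqn_pmul2l// => /eqP->.
have -> : (\sum_(i1 < m) \sum_(i2 < m') \sum_(i' : 'I_m * 'I_m')
   ((h * i1 + h' * i2) == (h * i'.1 + h' * i'.2)) =
  \sum_(i1 < m) \sum_(j2 < m') \sum_(i2 < m') \sum_(j1 < m)
    ((h * i1 + h' * i2) == (h * j1 + h' * j2)))%N.
  apply: eq_bigr => i1 _; rewrite [RHS]exchange_big/=; apply: eq_bigr => i2 _.
  rewrite -(pair_bigA _ (fun (j1 : 'I_m) (j2 : 'I_m') => 
     ((h * i1 + h' * i2)%N == (h * j1 + h' * j2)%N : nat)))%N/=.
  by rewrite [LHS]exchange_big.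
apply: (@leq_trans (m * m' * (m' %/ e).+1 * h)).
  rewrite leq_mul2r; apply/orP; right.
  apply: (@leq_trans (\sum_(i1 < m) \sum_(j2 < m') (m' %/ e).+1)).
    by apply: leq_sum => i1 _; apply: leq_sum => j2 _; exact: inner.
  by rewrite !sum_nat_const !card_ord mulnA.
rewrite -mulnA leq_mul2l; apply/orP; right.
rewrite [X in (_ * X)%N]he mulnA leq_mul2r; apply/orP; right.
rewrite mulSn; have := leq_trunc_div m' e; have : (e <= h)%N by exact: leq_div.
by move: hP mP; clear; lia.
Qed.

Lemma harmonic_le (F : numFieldType) k P :
  (P <= 2 ^ k)%N -> \sum_(h < P) (h%:R : F)^-1 <= k%:R.
Proof.
have pos h : 0 <= (h%:R : F)^-1 by rewrite invr_ge0.
move=> Pk; apply: (@le_trans _ _ (\sum_(h < 2 ^ k) (h%:R : F)^-1)).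
  rewrite (big_ord_widen _ (fun h => (h%:R : F)^-1) Pk) big_mkcond/=.
  by apply: ler_sum => h _; case: ifP.
elim: k {P Pk} => [|k IH]; first by rewrite expn0 big_ord1 invr0.
rewrite expnS mul2n -addnn big_split_ord/= -natr1 lerD// .
apply: (@le_trans _ _ (\sum_(i < 2 ^ k) ((2 ^ k)%:R : F)^-1)).
  by apply: ler_sum => i _; rewrite lef_pV2 ?posrE ?ltr0n ?ler_nat ?leq_addr ?addn_gt0 ?expn_gt0.
by rewrite sumr_const card_ord -[leLHS]mulr_natl mulfV// pnatr_eq0 -lt0n expn_gt0.
Qed.

(** Bound gcd(h, h') by the sum of all common divisors. *)
Lemma sum_gcdn_le h P : (0 < h < P)%N ->
  (\sum_(h' < P) gcdn h h' <=
   \sum_(g < P) ((0 < g)%N && (g %| h)%N) * (2 * P))%N.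
Proof.
move=> /andP[h0 hP].
apply: (@leq_trans (\sum_(h' < P) \sum_(g < P)
    ((0 < g)%N && (g %| h)%N) * ((h' == 0 %[mod g]) * g))).
  apply: leq_sum => h' _.
  have gP : (gcdn h h' < P)%N.
    by apply: leq_ltn_trans hP; rewrite dvdn_leq ?dvdn_gcdl.
  rewrite (bigD1 (Ordinal gP))//= gcdn_gt0 h0 dvdn_gcdl mod0n.
  by rewrite -/(dvdn _ _) dvdn_gcdr !mul1n leq_addr.
rewrite exchange_big/=; apply: leq_sum => g _.
have [/andP[g0 gh]|] := boolP ((0 < g)%N && (g %| h)%N); last by rewrite big1.
under eq_bigr do rewrite mul1n.
rewrite mul1n -big_distrl/=.
have := leq_mul (sum_modn_le P 0 g0) (leqnn g) => /leq_trans; apply.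
by rewrite mulSn; have := leq_trunc_div P g; have := ltn_ord g; lia.
Qed.

Lemma sum_gcdn_div_le (F : numFieldType) k P : (P <= 2 ^ k)%N ->
  \sum_(h < P | (0 < h)%N) \sum_(h' < P) (gcdn h h')%:R / (h%:R : F) <=
  (2 * P * k ^ 2)%:R.
Proof.
move=> Pk.
have pos n : 0 <= (n%:R : F)^-1 by rewrite invr_ge0.
apply: (@le_trans _ _ ((2 * P)%:R *
  \sum_(h < P) \sum_(g < P) \sum_(e < P)
     (h == (g * e)%N :> nat)%:R * ((g%:R : F)^-1 * e%:R^-1))); last first.
  rewrite [leRHS]natrM ler_pM//.
    apply: sumr_ge0 => h _; apply: sumr_ge0 => g _; apply: sumr_ge0 => e _.
    by rewrite !mulr_ge0.
  rewrite exchange_big/= natrX expr2.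
  apply: (@le_trans _ _ ((\sum_(g < P) (g%:R : F)^-1) * (\sum_(e < P) (e%:R : F)^-1))); last first.
    by rewrite ler_pM ?harmonic_le ?sumr_ge0.
  rewrite big_distrl/=; apply: ler_sum => g _.
  rewrite exchange_big big_distrr/=; apply: ler_sum => e _.
  rewrite -big_distrl/= -[leRHS]mul1r ler_wpM2r ?mulr_ge0//.
  have [geP|geP] := ltnP (g * e) P.
    rewrite (bigD1 (Ordinal geP))//= eqxx big1 ?addr0// => i ni.
    by case: eqP => // E; case/eqP: ni; apply: val_inj.
  rewrite big1// => h _; case: eqP => // E.
  by have := ltn_ord h; rewrite E ltnNge geP.
rewrite mulr_sumr big_mkcond/=; apply: ler_sum => h _.
case: ifP => [h0|_]; last first.
  rewrite mulr_ge0//; apply: sumr_ge0 => g _; apply: sumr_ge0 => e _.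
  by rewrite !mulr_ge0.
rewrite -mulr_suml -natr_sum.
have hP : (0 < h < P)%N by rewrite h0 ltn_ord.
apply: (@le_trans _ _
  ((\sum_(g < P) ((0 < g)%N && (g %| h)%N) * (2 * P))%:R / (h%:R : F))).
  by rewrite ler_wpM2r// ler_nat sum_gcdn_le.
rewrite -big_distrl/= mulnC natrM -mulrA ler_wpM2l// natr_sum mulr_suml.
apply: ler_sum => g _.
have [/andP[g0 gh]|_] := boolP ((0 < g)%N && (g %| h)%N); last first.
  by rewrite mul0r; apply: sumr_ge0 => e _; rewrite !mulr_ge0.
have eP : (h %/ g < P)%N by apply: leq_ltn_trans (ltn_ord h); exact: leq_div.
rewrite (bigD1 (Ordinal eP))//= mulnC divnK// eqxx !mul1r -invfM -natrM.
rewrite mulnC divnK// lerDl; apply: sumr_ge0 => e _; by rewrite !mulr_ge0.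
Qed.

(** * The mean square of the Weyl majorant *)

Lemma fejer_norm1 (C : numClosedFieldType) j : fejer (1 : C) j = (2 ^ j)%:R.
Proof.
rewrite /fejer /geom; under eq_bigr do rewrite expr1n.
by rewrite sumr_const card_ord normr_nat expr2 mulfK// gt_eqF// ltr0n expn_gt0.
Qed.

(** By orthogonality, the mean over a of the product of two Fejer kernels is, up
to normalization, the number of solutions of h n + h' n' = h m + h' m'; the modulus is too large for
congruences to hold without equality. *)
Lemma mean_fejer_prod (C : numClosedFieldType) (z : C) M P h h' j j' :
  M.-primitive_root z -> (4 * P ^ 2 <= M)%N -> (0 < h < P)%N -> (h' < P)%N ->
  (2 ^ j <= P)%N -> (2 ^ j' <= P)%N ->
  \sum_(a < M) fejer (z ^+ (2 * a * h)) j * fejer (z ^+ (2 * a * h')) j' <=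
  M%:R * ((2 * P)%:R * ((gcdn h h')%:R / h%:R)).
Proof.
move=> pz PM /andP[h0 hP] h'P jP j'P.
have P0 : (0 < P)%N by lia.
have M0 : (0 < M)%N by apply: leq_trans PM; rewrite muln_gt0 expn_gt0 P0.
pose I : finType := ('I_(2 ^ j) * 'I_(2 ^ j'))%type.
pose t (i : I) := (2 * (h * i.1 + h' * i.2))%N.
have tM (i : I) : (t i < M)%N.
  apply: leq_trans PM; rewrite /t (_ : 4 * P ^ 2 = 2 * (P * P + P * P))%N; last by lia.
  rewrite ltn_mul2l/= -addSn leq_add//.
    by rewrite ltn_mul// (leq_trans (ltn_ord _)).
  by rewrite leq_mul// ltnW// (leq_trans (ltn_ord _)).
have mj k : (0 : C) < (2 ^ k)%:R by rewrite ltr0n expn_gt0.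
have -> : \sum_(a < M) fejer (z ^+ (2 * a * h)) j * fejer (z ^+ (2 * a * h')) j'
    = (M%:R * (\sum_(i : I) \sum_(i' : I) (t i == t i'))%:R) /
      ((2 ^ j)%:R * (2 ^ j')%:R).
  rewrite -(parseval_roots M0 pz tM) mulr_suml; apply: eq_bigr => a _.
  rewrite /fejer mulrACA -invfM -exprMn -normrM; congr (`|_| ^+ 2 / _).
  rewrite /geom big_distrlr/= pair_bigA/=; apply: eq_bigr => -[i i'] _ /=.
  by rewrite -!exprM -exprD; congr (z ^+ _); rewrite /t/=; lia.
rewrite -mulrA ler_wpM2l// ler_pdivrMr ?mulr_gt0//.
rewrite mulrA mulrAC ler_pdivlMr ?ltr0n// -!natrM ler_nat.
have := @count_linear_le h h' (2 ^ j) (2 ^ j') P.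
rewrite h0 (ltnW hP) j'P => /(_ isT isT).
rewrite [X in (_ <= X)%N]mulnC; apply: leq_trans; rewrite leq_mul2r; apply/orP; right.
by apply: leq_sum => i _; apply: leq_sum => i' _; rewrite /t eqn_pmul2l.
Qed.

(** A bound for sum_h |sum_n e(2 a h n / M)|, the quantity that Weyl
differencing produces from the quadratic phase e(a n^2 / M), when z = e(1/M). *)
Definition weyl_majorant (C : numClosedFieldType) (z : C) P L a : C :=
  64 * \sum_(h < P) \sum_(j < L) fejer (z ^+ (2 * a * h)) j.

Lemma weyl_majorant_ge0 (C : numClosedFieldType) (z : C) P L a :
  0 <= weyl_majorant z P L a.
Proof.
rewrite mulr_ge0//; apply: sumr_ge0 => h _; apply: sumr_ge0 => j _.
exact: fejer_ge0.
Qed.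

Lemma mean_fejer_prod_sum (C : numClosedFieldType) (z : C) M P L j j' :
  M.-primitive_root z -> (4 * P ^ 2 <= M)%N -> (P <= 2 ^ L)%N -> (0 < L)%N ->
  (0 < P)%N -> (2 ^ j <= P)%N -> (2 ^ j' <= P)%N ->
  \sum_(h < P) \sum_(h' < P)
  \sum_(a < M) fejer (z ^+ (2 * a * h)) j * fejer (z ^+ (2 * a * h')) j' <=
  M%:R * (9 * P ^ 2 * L ^ 2)%:R.
Proof.
move=> pz PM PL L0 P0 jP j'P.
pose B (h h' : nat) : C := if h == 0%N then (if h' == 0%N then (P ^ 2)%:R
  else (2 * P)%:R) else (2 * P)%:R * ((gcdn h h')%:R / h%:R).
apply: (@le_trans _ _ (\sum_(h < P) \sum_(h' < P) M%:R * B h h')).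
  apply: ler_sum => h _; apply: ler_sum => h' _; rewrite /B.
  case: (posnP h) => [->|h0]; last by rewrite mean_fejer_prod// h0/=.
  case: (posnP h') => [->|h0]; last first.
    under eq_bigr do rewrite mulrC.
    have := @mean_fejer_prod _ z M P h' 0 j' j pz PM.
    by rewrite h0 ltn_ord gcdn0 mulfV ?mulr1 ?pnatr_eq0 -?lt0n//; apply.
  under eq_bigr do rewrite muln0 expr0 !fejer_norm1.
  rewrite sumr_const card_ord -[leLHS]mulr_natl ler_wpM2l// -natrM ler_nat.
  by rewrite -mulnn leq_mul.
under eq_bigr do rewrite -mulr_sumr.
rewrite -mulr_sumr ler_wpM2l//.
rewrite (bigID (fun h : 'I_P => (0 < h)%N))/= addrC.
apply: (@le_trans _ _ ((P ^ 2 + 2 * P * P)%:R + (2 * P * (2 * P * L ^ 2))%:R)).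
  apply: lerD; last first.
    apply: (@le_trans _ _ ((2 * P)%:R * \sum_(h < P | (0 < h)%N)
      \sum_(h' < P) (gcdn h h')%:R / (h%:R : C))); last first.
      by rewrite [leRHS]natrM ler_wpM2l//; exact: sum_gcdn_div_le.
    rewrite mulr_sumr; apply: ler_sum => h h0; rewrite mulr_sumr.
    by apply: ler_sum => h' _; rewrite /B gtn_eqF.
  rewrite (big_pred1 (Ordinal P0)); last by move=> i /=; rewrite -leqNgt leqn0.
  rewrite (bigD1 (Ordinal P0))//= natrD lerD// natrM mulr_natr.
  apply: le_trans (ler_sum (G := fun=> (2 * P)%:R) _ _) _.
    by move=> i ni; rewrite /B/= ifN.
  rewrite sumr_const ler_wpMn2l// -[X in (_ <= X)%N](card_ord P).
  exact: max_card.
by rewrite -natrD ler_nat; move: L0; case: (L) => // l _; nia.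
Qed.

(** The decisive mean value. The square is expanded into products of two
Fejer kernels, whose means are governed by the sum of gcd(h, h') / h over
h, h' < P, which is P up to logarithms. The result P^2 has the order of magnitude of
lam when P is about the radius of the sphere. *)
Lemma weyl_majorant_moment (C : numClosedFieldType) (z : C) M P L :
  M.-primitive_root z -> (4 * P ^ 2 <= M)%N -> (P <= 2 ^ L)%N -> (0 < L)%N ->
  (2 ^ L.-1 <= P)%N ->
  \sum_(a < M) weyl_majorant z P L a ^+ 2 <=
  M%:R * (64 ^ 2 * 9 * P ^ 2 * L ^ 4)%:R.
Proof.
move=> pz PM PL L0 LP.
have P0 : (0 < P)%N by apply: leq_trans LP; rewrite expn_gt0.
have jP (j : 'I_L) : (2 ^ j <= P)%N.
  by apply: leq_trans LP; rewrite leq_exp2l// -ltnS prednK.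
have -> : \sum_(a < M) weyl_majorant z P L a ^+ 2 = (64 ^ 2)%:R *
   \sum_(j < L) \sum_(j' < L) \sum_(h < P) \sum_(h' < P) \sum_(a < M)
     fejer (z ^+ (2 * a * h)) j * fejer (z ^+ (2 * a * h')) j'.
  under eq_bigr do rewrite /weyl_majorant exprMn -natrX.
  rewrite -mulr_sumr; congr (_ * _).
  under eq_bigr do rewrite exchange_big expr2 big_distrlr/=.
  rewrite exchange_big/=; apply: eq_bigr => j _.
  rewrite exchange_big/=; apply: eq_bigr => j' _.
  under eq_bigr do rewrite big_distrlr/=.
  rewrite exchange_big/=; apply: eq_bigr => h _.
  by rewrite exchange_big.
rewrite (_ : (64 ^ 2 * 9 * P ^ 2 * L ^ 4)%:R =
  (64 ^ 2)%:R * (L * (L * (9 * P ^ 2 * L ^ 2)))%:R :> C); last first.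
  by rewrite -natrM; congr (_%:R); lia.
rewrite mulrCA ler_wpM2l//.
apply: (@le_trans _ _ (\sum_(j < L) \sum_(j' < L) M%:R * (9 * P ^ 2 * L ^ 2)%:R : C)).
  by apply: ler_sum => j _; apply: ler_sum => j' _; exact: mean_fejer_prod_sum.
rewrite !sumr_const card_ord -mulrnA -[leLHS]mulr_natr -mulrA -natrM.
by rewrite ler_wpM2l// ler_nat; apply: eq_leq; lia.
Qed.

(** * Boxes in the lattice *)

Lemma ler_sum_uniq_sub (C : numDomainType) (T : eqType) (s1 s2 : seq T)
    (c : T -> C) :
  uniq s1 -> uniq s2 -> {subset s1 <= s2} -> (forall x, 0 <= c x) ->
  \sum_(x <- s1) c x <= \sum_(x <- s2) c x.
Proof.
move=> u1 u2 s12 c0.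
have p : perm_eq s1 [seq x <- s2 | x \in s1].
  apply: uniq_perm; rewrite ?filter_uniq// => x; rewrite mem_filter.
  by case: (boolP (x \in s1)) => //= /s12 ->.
rewrite (perm_big _ p)/= big_filter big_mkcond/=.
by apply: ler_sum => x _; case: ifP.
Qed.

Definition inbox d n (u : 'rV[int]_d) := [forall c, `|u 0 c| <= n%:Z].

Definition boxvec d n (f : {ffun 'I_d -> 'I_(n.*2.+1)}) : 'rV[int]_d :=
  \row_c ((f c)%:Z - n%:Z).

Lemma boxvec_inj d n : injective (@boxvec d n).
Proof.
move=> f g /matrixP fg; apply/ffunP => c; apply: val_inj => /=.
by have := fg 0 c; rewrite !mxE => /addIr [].
Qed.

Lemma boxvec_inbox d n f : inbox n (@boxvec d n f).
Proof.
apply/forallP => c; rewrite mxE; have := ltn_ord (f c); lia.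
Qed.

Lemma inboxP d n (u : 'rV[int]_d) : inbox n u -> exists f, u = boxvec (n := n) f.
Proof.
move=> /forallP uP.
have lt c : (`|(u 0 c + n%:Z)%R| < n.*2.+1)%N by have := uP c; lia.
exists [ffun c => Ordinal (lt c)]; apply/rowP => c.
by rewrite !mxE ffunE/=; have := uP c; lia.
Qed.

Lemma normsq_inbox d n lam (u : 'rV[int]_d) :
  (lam < n.+1 ^ 2)%N -> normsq u = lam%:Z -> inbox n u.
Proof.
move=> lamn uE; apply/forallP => c.
have : u 0 c ^+ 2 <= lam%:Z.
  by rewrite -uE /normsq (bigD1 c)//= lerDl sumr_ge0// => i _; exact: sqr_ge0.
by move: lamn; set t := u 0 c; clear; nia.
Qed.

Lemma sum_translate_box (V : nmodType) d n (X : seq 'rV[int]_d) y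
    (c : 'rV[int]_d -> V) :
  uniq X -> (forall f, y + boxvec (n := n) f \in X) ->
  \sum_(x <- X | inbox n (x - y)) c x = \sum_f c (y + boxvec (n := n) f).
Proof.
move=> uX yX; rewrite -big_filter.
have p : perm_eq [seq x <- X | inbox n (x - y)]
    [seq y + boxvec (n := n) f | f <- index_enum _].
  apply: uniq_perm; rewrite ?filter_uniq//.
    by rewrite map_inj_uniq ?index_enum_uniq// => f g /addrI/boxvec_inj.
  move=> x; rewrite mem_filter; apply/andP/mapP => [[/inboxP[f xf] _]|[f _ ->]].
    by exists f; rewrite ?mem_index_enum// -xf addrC subrK.
  by rewrite yX addrC addKr boxvec_inbox.
by rewrite (perm_big _ p)/= big_map.
Qed.

Lemma sum_box_le (C : numDomainType) d n (F : seq 'rV[int]_d) y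
    (c : 'rV[int]_d -> C) :
  uniq F -> (forall x, 0 <= c x) -> (forall x, ~~ inbox n x -> c x = 0) ->
  \sum_(x <- F) c (x - y) <= \sum_f c (boxvec (n := n) f).
Proof.
move=> uF c0 cout; pose X := undup (F ++ [seq y + boxvec (n := n) f | f <- enum predT]).
apply: (@le_trans _ _ (\sum_(x <- X) c (x - y))).
  apply: ler_sum_uniq_sub; rewrite ?undup_uniq// => x xF.
  by rewrite mem_undup mem_cat xF.
rewrite (bigID (fun x => inbox n (x - y)))/=.
rewrite [X in _ + X]big1 ?addr0; last by move=> x /cout.
rewrite (@sum_translate_box _ _ n) ?undup_uniq//.
  by rewrite le_eqVlt; apply/orP; left; apply/eqP/eq_bigr => f _; rewrite addrC addKr.
move=> f; rewrite mem_undup mem_cat; apply/orP; right.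
by apply/mapP; exists f; rewrite ?mem_enum.
Qed.

Lemma sqr_sum_le (C : numDomainType) (T : Type) (s : seq T) (v : T -> C) :
  (forall x, v x \is Num.real) ->
  (\sum_(x <- s) v x) ^+ 2 <= (size s)%:R * \sum_(x <- s) v x ^+ 2.
Proof.
move=> vr; rewrite -(@ler_pM2l _ 2)//.
have -> : 2 * ((size s)%:R * \sum_(x <- s) v x ^+ 2) =
    \sum_(x <- s) \sum_(y <- s) (v x ^+ 2 + v y ^+ 2).
  rewrite [RHS](eq_bigr (fun x => v x ^+ 2 *+ size s + \sum_(y <- s) v y ^+ 2)).
    rewrite big_split/= sumrMnl big_const_seq iter_addr_0 count_predT.
    by rewrite -mulr_natl; ring.
  by move=> x _; rewrite big_split/= big_const_seq iter_addr_0 count_predT.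
rewrite expr2 big_distrlr/= mulr_sumr; apply: ler_sum => x _.
rewrite mulr_sumr; apply: ler_sum => y _.
by rewrite -subr_ge0 (_ : _ - _ = (v x - v y) ^+ 2) ?real_exprn_even_ge0 ?rpredB//; ring.
Qed.

(** * Quadratic phases on boxes *)

(** The quadratic phase e(a m^2 / M) cut off to |m| <= N, with z = e(1/M). *)
Definition chirp (C : numClosedFieldType) (z : C) (a N : nat) (m : int) : C :=
  if `|m| <= N%:Z then z ^ (a%:Z * m ^+ 2) else 0.

(** Autocorrelation of the chirp: the phase m^2 - (m - h)^2 is linear in m, so
this is a geometric sum of ratio z^(2 a h). *)
Definition chirp_corr (C : numClosedFieldType) (z : C) (a N : nat) (h : int) : C :=
  \sum_(i < N.*2.+1) chirp z a N (i%:Z - N%:Z) * (chirp z a N (i%:Z - N%:Z - h))^*.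

Lemma norm_exprz1 (C : numClosedFieldType) (z : C) (t : int) :
  `|z| = 1 -> `|z ^ t| = 1.
Proof.
move=> z1; case: t => n; rewrite ?NegzE -?invr_expz ?normfV.
  by rewrite -exprnP normrX z1 expr1n.
by rewrite -exprnP normrX z1 expr1n invr1.
Qed.

Lemma conj_exprz (C : numClosedFieldType) (z : C) (t : int) :
  `|z| = 1 -> (z ^ t)^* = z ^ (- t).
Proof.
by move=> z1; rewrite -invr_expz invC_norm norm_exprz1// expr1n invr1 mul1r.
Qed.

Lemma chirp_mul_conj (C : numClosedFieldType) (z : C) (a N : nat) (m m' : int) :
  `|z| = 1 -> `|m| <= N%:Z -> `|m'| <= N%:Z ->
  chirp z a N m * (chirp z a N m')^* = z ^ (a%:Z * (m ^+ 2 - m' ^+ 2)).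
Proof.
move=> z1 mN mN'; rewrite /chirp mN mN' conj_exprz// -expfzDr ?mulrBr//.
by rewrite -normr_eq0 z1 oner_eq0.
Qed.

Lemma norm_chirp_corr (C : numClosedFieldType) (z : C) (a N : nat) (h : nat) :
  `|z| = 1 -> (h <= N.*2)%N ->
  `|chirp_corr z a N h%:Z| = `|geom (z ^+ (2 * a * h)) (N.*2.+1 - h)| /\
  `|chirp_corr z a N (- h%:Z)| = `|geom (z ^+ (2 * a * h)) (N.*2.+1 - h)|.
Proof.
move=> z1 hN; have zn0 : z != 0 by rewrite -normr_eq0 z1 oner_eq0.
split.
  rewrite /chirp_corr -(big_mkord xpredT (fun i => chirp z a N (i%:Z - N%:Z) * (chirp z a N (i%:Z - N%:Z - h%:Z))^*)).
  rewrite (@big_cat_nat _ _ _ h)//=; last by rewrite ltnW.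
  rewrite big_nat big1 ?add0r; last first.
    move=> i /andP[_ ih]; rewrite [in X in _ * X]/chirp ifF ?conjC0 ?mulr0//.
    by apply/negbTE; lia.
  rewrite -{1}[h]add0n big_addn big_mkord.
  rewrite (eq_bigr (fun i : 'I_(N.*2.+1 - h) => z ^ (a%:Z * (h%:Z * (h%:Z - 2 * N%:Z))) * (z ^+ (2 * a * h)) ^+ i)); last first.
    move=> i _; have := ltn_ord i => iN; rewrite chirp_mul_conj//; try lia.
    rewrite -exprM [z ^+ _]exprnP -expfzDr//; congr (z ^ _).
    by rewrite !PoszM PoszD; ring.
  by rewrite -mulr_sumr normrM norm_exprz1// mul1r.
rewrite /chirp_corr -(big_mkord xpredT (fun i => chirp z a N (i%:Z - N%:Z) * (chirp z a N (i%:Z - N%:Z - - h%:Z))^*)).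
rewrite (@big_cat_nat _ _ _ (N.*2.+1 - h))//=; last by rewrite leq_subr.
rewrite [X in _ + X]big_nat [X in _ + X]big1 ?addr0; last first.
  move=> i /andP[ih iN]; rewrite [in X in _ * X]/chirp ifF ?conjC0 ?mulr0//.
  by apply/negbTE; lia.
rewrite big_mkord.
rewrite (eq_bigr (fun i : 'I_(N.*2.+1 - h) => z ^ (a%:Z * (h%:Z * (2 * N%:Z - h%:Z))) * ((z ^+ (2 * a * h)) ^+ i)^*)); last first.
  move=> i _; have := ltn_ord i => iN; rewrite chirp_mul_conj//; try lia.
  rewrite -exprM [z ^+ _]exprnP conj_exprz// -expfzDr//; congr (z ^ _).
  by rewrite !PoszM; ring.
by rewrite -mulr_sumr normrM norm_exprz1// mul1r -rmorph_sum norm_conjC.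
Qed.

Lemma chirp_corr_out (C : numClosedFieldType) (z : C) (a N : nat) (h : int) :
  (N.*2)%:Z < `|h| -> chirp_corr z a N h = 0.
Proof.
move=> hN; rewrite /chirp_corr big1// => i _; have := ltn_ord i => iN.
rewrite [in X in _ * X]/chirp ifF ?conjC0 ?mulr0//.
by apply/negbTE; lia.
Qed.

Lemma chirp_corr_le (C : numClosedFieldType) (z : C) (a N L : nat) (h : int) :
  `|z| = 1 -> (N.*2.+1 < 2 ^ L)%N ->
  (`|h| <= N.*2)%N ->
  `|chirp_corr z a N h| <= 32 * \sum_(j < L) fejer (z ^+ (2 * a * `|h|)) j.
Proof.
move=> z1; case: L => [|L]; first by rewrite expn0.
move=> NL hN.
have -> : `|chirp_corr z a N h| = `|geom (z ^+ (2 * a * `|h|)) (N.*2.+1 - `|h|)|.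
  by case: (norm_chirp_corr a z1 hN) => e1 e2; case: (intP h) e1 e2 => [|n|n]; rewrite ?abszN !absz_nat.
apply: norm_geom_fejer; first by rewrite normrX z1 expr1n.
by apply: leq_ltn_trans NL; rewrite leq_subr.
Qed.

Lemma sum_chirp_corr_le (C : numClosedFieldType) (z : C) (a N L : nat) :
  `|z| = 1 -> (N.*2.+1 < 2 ^ L)%N ->
  \sum_(i < (N.*2).*2.+1) `|chirp_corr z a N (i%:Z - (N.*2)%:Z)| <=
  weyl_majorant z N.*2.+1 L a.
Proof.
move=> z1 NL; pose W n : C := 32 * \sum_(j < L) fejer (z ^+ (2 * a * n)) j.
have W0 n : 0 <= W n.
  by rewrite mulr_ge0//; apply: sumr_ge0 => j _; exact: fejer_ge0.
apply: (@le_trans _ _ (\sum_(i < (N.*2).*2.+1) W `|(i%:Z - (N.*2)%:Z)%R|%N)).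
  apply: ler_sum => i _; apply: chirp_corr_le => //.
  by have := ltn_ord i; lia.
rewrite -(big_mkord xpredT (fun i : nat => W `|(i%:Z - (N.*2)%:Z)%R|%N)).
rewrite (@big_cat_nat _ _ _ N.*2)//=; last by lia.
have -> : weyl_majorant z N.*2.+1 L a = \sum_(h < N.*2.+1) W h + \sum_(h < N.*2.+1) W h.
  by rewrite -mulr_sumr /weyl_majorant; ring.
apply: lerD; last first.
  rewrite -{1}[N.*2]add0n big_addn (_ : _ - N.*2 = N.*2.+1)%N; last by lia.
  by rewrite big_mkord; apply: ler_sum => i _; rewrite PoszD addrK absz_nat.
rewrite big_nat_rev/= big_mkord add0n big_ord_recl/=.
rewrite (eq_bigr (fun i : 'I_N.*2 => W (bump 0 i))).
  by rewrite lerDr.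
move=> i _; congr W; have := ltn_ord i; rewrite /bump/=; lia.
Qed.

Definition box_chirp (C : numClosedFieldType) (z : C) (a N : nat) d
  (u : 'rV[int]_d) : C := \prod_(c < d) chirp z a N (u 0 c).

(** The squared Euclidean norm is additive over coordinates, so the cut-off
phase on a box of Z^d is a product of one-dimensional chirps. *)
Lemma box_chirpE (C : numClosedFieldType) (z : C) (a N : nat) d
    (u : 'rV[int]_d) : z != 0 ->
  box_chirp z a N u = if inbox N u then z ^ (a%:Z * normsq u) else 0.
Proof.
move=> z0; case: ifPn => [/forallP uN|/forallPn[c uc]]; last first.
  by rewrite /box_chirp (bigD1 c)//= /chirp (negbTE uc) mul0r.
rewrite /box_chirp /normsq mulr_sumr.
rewrite (big_morph (fun t : int => z ^ t) (fun s t => expfzDr s t z0) (expr0z z)).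
by apply: eq_bigr => c _; rewrite /chirp uN.
Qed.

Lemma norm_box_chirp_le1 (C : numClosedFieldType) (z : C) (a N : nat) d
    (u : 'rV[int]_d) : `|z| = 1 -> `|box_chirp z a N u| <= 1.
Proof.
move=> z1; have z0 : z != 0 by rewrite -normr_eq0 z1 oner_eq0.
by rewrite box_chirpE//; case: ifP => _; rewrite ?normr0 ?norm_exprz1.
Qed.

(** The operator with kernel box_chirp (x - y) composed with its adjoint has
the kernel prod_c chirp_corr (z_c). Schur's test bounds its norm by the sum of
the absolute values of this kernel, which factors over the coordinates. *)
Lemma box_chirp_tt (C : numClosedFieldType) (z : C) (a N L d : nat)
    (F X : seq 'rV[int]_d) :
  `|z| = 1 -> (N.*2.+1 < 2 ^ L)%N -> uniq F -> uniq X ->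
  (forall y f, y \in F -> y + boxvec (n := N) f \in X) ->
  \sum_(x <- X) `|\sum_(y <- F) box_chirp z a N (x - y)| ^+ 2 <=
  (size F)%:R * weyl_majorant z N.*2.+1 L a ^+ d.
Proof.
move=> z1 NL uF uX FX.
have z0 : z != 0 by rewrite -normr_eq0 z1 oner_eq0.
pose K (w : 'rV[int]_d) := \prod_(c < d) chirp_corr z a N (w 0 c).
have KE y y' : y \in F -> \sum_(x <- X) box_chirp z a N (x - y) *
    (box_chirp z a N (x - y'))^* = K (y' - y).
  move=> yF; rewrite (bigID (fun x => inbox N (x - y)))/= [X in _ + X]big1 ?addr0; last first.
    by move=> x /negbTE nx; rewrite [in X in X * _]box_chirpE// nx mul0r.
  rewrite (@sum_translate_box _ _ N)//; last by move=> f; exact: FX.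
  rewrite /K /chirp_corr bigA_distr_bigA/=; apply: eq_bigr => f _.
  rewrite /box_chirp rmorph_prod -big_split/=; apply: eq_bigr => c _.
  by rewrite !mxE; congr (chirp _ _ _ _ * (chirp _ _ _ _)^*); ring.
have sumE : \sum_(x <- X) `|\sum_(y <- F) box_chirp z a N (x - y)| ^+ 2 =
    \sum_(y <- F) \sum_(y' <- F) K (y' - y).
  rewrite (eq_bigr _ (fun a _ => normCK _)).
  under eq_bigr do rewrite rmorph_sum big_distrlr/=.
  rewrite exchange_big/= big_seq [RHS]big_seq; apply: eq_bigr => y yF.
  by rewrite exchange_big/=; apply: eq_bigr => y' _; exact: KE.
rewrite -[leLHS]ger0_norm; last by apply: sumr_ge0 => x _; rewrite exprn_ge0.
rewrite sumE; apply: le_trans (ler_norm_sum _ _ _) _.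
have main (y : 'rV[int]_d) : true ->
  `|\sum_(y' <- F) K (y' - y)| <= weyl_majorant z N.*2.+1 L a ^+ d.
  move=> _; apply: le_trans (ler_norm_sum _ _ _) _.
  apply: (@le_trans _ _ (\sum_f `|K (boxvec (n := N.*2) f)|)).
    apply: (@sum_box_le _ _ _ _ _ (fun x => `|K x|)) => // x /forallPn[c xc].
    rewrite /K (bigD1 c)//= chirp_corr_out ?mul0r ?normr0//.
    by rewrite real_ltNge ?num_real.
  rewrite -[d in _ ^+ d]card_ord -prodr_const.
  apply: (@le_trans _ _ (\prod_(c < d) \sum_(i < (N.*2).*2.+1)
      `|chirp_corr z a N (i%:Z - (N.*2)%:Z)|)).
    rewrite bigA_distr_bigA/=; apply: ler_sum => f _.
    by rewrite /K normr_prod; apply: ler_prod => c _; rewrite !mxE normr_ge0 lexx.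
  apply: ler_prod => c _; rewrite sumr_ge0//=.
  exact: sum_chirp_corr_le.
apply: le_trans (ler_sum _ main) _.
by rewrite big_const_seq iter_addr_0 count_predT mulr_natl.
Qed.

Definition chirp_form (C : numClosedFieldType) (z : C) (a N d : nat)
  (G F : seq 'rV[int]_d) : C :=
  \sum_(x <- G) \sum_(y <- F) box_chirp z a N (x - y).

Lemma chirp_form_le_card (C : numClosedFieldType) (z : C) (a N d : nat)
  (G F : seq 'rV[int]_d) : `|z| = 1 ->
  `|chirp_form z a N G F| <= (size G * size F)%:R.
Proof.
move=> z1; apply: le_trans (ler_norm_sum _ _ _) _.
apply: (@le_trans _ _ (\sum_(x <- G) (size F)%:R)).
  apply: ler_sum => x _; apply: le_trans (ler_norm_sum _ _ _) _.
  apply: (@le_trans _ _ (\sum_(y <- F) 1)).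
    by apply: ler_sum => y _; exact: norm_box_chirp_le1.
  by rewrite big_const_seq iter_addr_0 count_predT.
by rewrite big_const_seq iter_addr_0 count_predT mulnC natrM mulr_natr.
Qed.

Lemma chirp_form_sqr_le (C : numClosedFieldType) (z : C) (a N L d : nat)
  (G F : seq 'rV[int]_d) :
  `|z| = 1 -> (N.*2.+1 < 2 ^ L)%N -> uniq F -> uniq G ->
  `|chirp_form z a N G F| ^+ 2 <=
  (size G * size F)%:R * weyl_majorant z N.*2.+1 L a ^+ d.
Proof.
move=> z1 NL uF uG.
pose X := undup (G ++ [seq y + boxvec (n := N) f | y <- F, f <- enum predT]).
have GX : {subset G <= X} by move=> x xG; rewrite mem_undup mem_cat xG.
have FX y f : y \in F -> y + boxvec (n := N) f \in X.
  move=> yF; rewrite mem_undup mem_cat; apply/orP; right.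
  by apply/allpairsP; exists (y, f); rewrite mem_enum.
apply: (@le_trans _ _ ((\sum_(x <- G) `|\sum_(y <- F) box_chirp z a N (x - y)|) ^+ 2)).
  by rewrite lerXn2r ?nnegrE ?sumr_ge0// ler_norm_sum.
apply: le_trans (sqr_sum_le _ _) _; first by move=> x; rewrite normr_real.
rewrite natrM -mulrA ler_wpM2l//.
apply: le_trans (ler_sum_uniq_sub uG (undup_uniq _) GX _) _.
  by move=> x; rewrite exprn_ge0.
exact: (box_chirp_tt a z1 NL uF (undup_uniq _) FX).
Qed.

(** * Incidences with a sphere *)

(** Let Q be the number of pairs of G x F at squared distance lam, and let B be
the last factor without its exponent d. Detect the equation by averaging the
phases e(a (|x - y|^2 - lam) / M) over a modulo M. With n = |G| |F| and s the
Weyl majorant, the form at frequency a is at most n, and at most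
(n s^d)^(1/2); the geometric mean of these with weights 1 - 4/d and 4/d is
n^(1 - 2/d) s^2, and the mean over a of s^2 is at most B. Everything is raised
to the power d to stay among natural numbers. *)
Lemma incidence_le (N L lam d : nat) (G F : seq 'rV[int]_d) :
  (N ^ 2 <= lam < N.+1 ^ 2)%N -> (0 < N)%N ->
  (4 <= d)%N -> (2 ^ L.-1 <= N.*2.+1 < 2 ^ L)%N -> uniq G -> uniq F ->
  ((\sum_(x <- G) \sum_(y <- F) (normsq (x - y)%R == lam%:Z)) ^ d <=
   (size G * size F) ^ (d - 2) *
   (64 ^ 2 * 9 * N.*2.+1 ^ 2 * L ^ 4) ^ d)%N.
Proof.
move=> /andP[Nlam lamN] N0 d4 /andP[LN NL] uG uF.
have L0 : (0 < L)%N by case: (L) NL => //; rewrite expn0.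
pose M := (4 * N.*2.+1 ^ 2 + d * lam)%N.+1.
have [z pz] := C_prim_root_exists (ltn0Sn _ : 0 < M)%N.
have z1 := prim_root_norm1 (ltn0Sn _) pz.
have z0 : z != 0 by rewrite -normr_eq0 z1 oner_eq0.
set Q := (\sum_(x <- G) \sum_(y <- F) (normsq (x - y)%R == lam%:Z))%N.
set B := (64 ^ 2 * 9 * N.*2.+1 ^ 2 * L ^ 4)%N.
set n := (size G * size F)%N.
pose s a := weyl_majorant z N.*2.+1 L a.
have normsqE (u : 'rV[int]_d) : normsq u = `|normsq u|%N.
  by rewrite gez0_abs// sumr_ge0// => c _; exact: sqr_ge0.
have normsq_box (u : 'rV[int]_d) : inbox N u -> (`|normsq u|%N <= d * lam)%N.
  move=> /forallP uN; rewrite -lez_nat -normsqE.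
  apply: (@le_trans _ _ (\sum_(c < d) lam%:Z)).
    apply: ler_sum => c _; rewrite -real_normK ?num_real//.
    apply: (@le_trans _ _ (N%:Z ^+ 2)); first by rewrite lerXn2r ?nnegrE.
    by rewrite expr2 -PoszM lez_nat mulnn.
  by rewrite sumr_const card_ord -mulr_natl PoszM natz.
have box_sphere (u : 'rV[int]_d) : normsq u = lam%:Z -> inbox N u.
  exact: normsq_inbox.
(* Inside the box, |x - y|^2 and lam are smaller than M, so congruence is equality. *)
have MQ : M%:R * (Q%:R : algC) =
    \sum_(a < M) (z ^+ (a * lam))^* * chirp_form z a N G F.
  under [RHS]eq_bigr do rewrite /chirp_form mulr_sumr.
  rewrite [RHS]exchange_big/= /Q natr_sum [LHS]mulr_sumr; apply: eq_bigr => x _.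
  under [RHS]eq_bigr do rewrite mulr_sumr.
  rewrite [RHS]exchange_big/= natr_sum [LHS]mulr_sumr; apply: eq_bigr => y _.
  case: (boolP (inbox N (x - y))) => [xyN|xyN]; last first.
    rewrite [RHS]big1; last by move=> a _; rewrite box_chirpE// (negbTE xyN) mulr0.
    case: eqP => [/box_sphere xyN'|]; last by rewrite mulr0.
    by rewrite xyN' in xyN.
  have -> : (normsq (x - y) == lam) = (`|normsq (x - y)%R|%N == lam).
    by rewrite normsqE absz_nat eqz_nat.
  rewrite -(@sum_roots _ z M)//; last 2 first.
  - by rewrite /M; have := normsq_box _ xyN; lia.
  - by rewrite /M; nia.
  apply: eq_bigr => a _; rewrite mulrC box_chirpE// xyN {2}normsqE -PoszM.
  by rewrite -exprnP.
pose rho : algC := d.-root (n ^ (d - 2))%:R.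
have d0 : (0 < d)%N by apply: leq_trans d4.
have rho0 : 0 <= rho by rewrite rootC_ge0.
have s0 a : 0 <= s a := weyl_majorant_ge0 _ _ _ _.
have Phi_le a : `|chirp_form z a N G F| <= rho * s a ^+ 2.
  have sk0 k : 0 <= s a ^+ k by exact: exprn_ge0.
  have rs0 : 0 <= rho * s a ^+ 2 by exact: mulr_ge0.
  have ns0 : 0 <= n%:R * s a ^+ d by exact: mulr_ge0.
  rewrite -(ler_pXn2r d0) ?nnegrE//.
  rewrite exprMn rootCK//.
  have -> : `|chirp_form z a N G F| ^+ d = `|chirp_form z a N G F| ^+ (d - 4) *
      (`|chirp_form z a N G F| ^+ 2) ^+ 2.
    by rewrite -exprM -exprD; congr (_ ^+ _); move: d4; clear; lia.
  have -> : (n ^ (d - 2))%:R * (s a ^+ 2) ^+ d = n%:R ^+ (d - 4) * (n%:R * s a ^+ d) ^+ 2.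
    rewrite [in RHS]exprMn mulrA -exprD -!exprM [(d * 2)%N]mulnC natrX.
    by congr (_ ^+ _ * _); move: d4; clear; lia.
  apply: ler_pM; rewrite ?exprn_ge0//.
    by rewrite lerXn2r ?nnegrE//; exact: chirp_form_le_card.
  by rewrite lerXn2r ?nnegrE ?exprn_ge0//; exact: chirp_form_sqr_le.
have MQ_le : M%:R * (Q%:R : algC) <= M%:R * (rho * B%:R).
  rewrite -[leLHS]ger0_norm ?mulr_ge0// MQ.
  apply: le_trans (ler_norm_sum _ _ _) _.
  apply: (@le_trans _ _ (\sum_(a < M) rho * s a ^+ 2)).
    apply: ler_sum => a _; rewrite normrM norm_conjC normrX z1 expr1n mul1r.
    exact: Phi_le.
  rewrite -mulr_sumr mulrCA ler_wpM2l//.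
  by apply: weyl_majorant_moment => //; [rewrite /M; lia|exact: ltnW].
have Q_le : (Q%:R : algC) <= rho * B%:R by move: MQ_le; rewrite ler_pM2l ?ltr0n.
rewrite -(@ler_nat algC) natrM !natrX.
apply: le_trans (lerXn2r d _ _ Q_le) _; rewrite ?nnegrE ?mulr_ge0//.
by rewrite exprMn rootCK// natrX.
Qed.

Definition sphere d lam : seq 'rV[int]_d :=
  [seq u <- [seq boxvec (n := lam) f | f <- enum predT] | normsq u == lam%:Z].
Arguments sphere : clear implicits.

Lemma sphere_uniq d lam : uniq (sphere d lam).
Proof. by rewrite filter_uniq// map_inj_uniq ?enum_uniq//; exact: boxvec_inj. Qed.

Lemma mem_sphere d lam (u : 'rV[int]_d) : (u \in sphere d lam) = (normsq u == lam%:Z).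
Proof.
rewrite mem_filter; apply/andP/idP => [[]//|/eqP uE]; split; first exact/eqP.
have /(normsq_inbox)/(_ uE)/inboxP[f ->] : (lam < lam.+1 ^ 2)%N by nia.
by apply: map_f; rewrite mem_enum.
Qed.

Definition shell_count d lam (F : seq 'rV[int]_d) (x : 'rV[int]_d) : nat :=
  (\sum_(u <- sphere d lam) ((x - u)%R \in F))%N.

Lemma sum_nat_of_bool (T : Type) (s : seq T) (b : T -> bool) :
  (\sum_(x <- s) b x = size [seq x <- s | b x])%N.
Proof.
elim: s => [|x s IH]; rewrite ?big_nil//= big_cons IH; by case: (b x).
Qed.

Lemma shell_countE d lam (F : seq 'rV[int]_d) x : uniq F ->
  (shell_count lam F x = \sum_(y <- F) (normsq (x - y)%R == lam%:Z))%N.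
Proof.
move=> uF; rewrite /shell_count !sum_nat_of_bool -(size_map (fun u => x - u)).
apply/perm_size/uniq_perm.
- rewrite map_inj_uniq; first by apply: filter_uniq; exact: sphere_uniq.
  by move=> u v /addrI/oppr_inj.
- exact: filter_uniq.
move=> y; rewrite mem_filter; apply/mapP/andP => [[u]|[xy yF]].
  by rewrite mem_filter mem_sphere => /andP[uF' uS] ->; rewrite opprB addrC subrK.
have xyK : x - (x - y) = y by rewrite opprB addrC subrK.
by exists (x - y); rewrite // mem_filter xyK mem_sphere yF.
Qed.

Lemma shell_count_le_size d lam (F : seq 'rV[int]_d) x : uniq F ->
  (shell_count lam F x <= size F)%N.
Proof. by move=> uF; rewrite shell_countE// sum_nat_of_bool size_filter count_size. Qed.

Lemma shell_count_le_sphere d lam (F : seq 'rV[int]_d) x :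
  (shell_count lam F x <= size (sphere d lam))%N.
Proof. by rewrite /shell_count sum_nat_of_bool size_filter count_size. Qed.

Lemma normsqN d (u : 'rV[int]_d) : normsq (- u) = normsq u.
Proof. by apply: eq_bigr => c _; rewrite mxE sqrrN. Qed.

Lemma sum_shell_count_le d lam (F G : seq 'rV[int]_d) : uniq F -> uniq G ->
  (\sum_(x <- G) shell_count lam F x <= size F * size (sphere d lam))%N.
Proof.
move=> uF uG; under eq_bigr do rewrite shell_countE//.
rewrite exchange_big/=.
apply: (@leq_trans (\sum_(y <- F) size (sphere d lam))).
  apply: leq_sum => y _.
  under eq_bigr do rewrite -opprB normsqN.
  by rewrite -shell_countE// shell_count_le_sphere.
by rewrite big_const_seq iter_addn_0 count_predT mulnC.
Qed.

(** The incidence bound between the box of radius N and the box of radius 2N: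
each point of the first sees a whole sphere in the second. *)
Lemma size_sphere_le N L lam d :
  (N ^ 2 <= lam < N.+1 ^ 2)%N -> (0 < N)%N ->
  (4 <= d)%N -> (2 ^ L.-1 <= N.*2.+1 < 2 ^ L)%N ->
  (size (sphere d lam) <=
   2 ^ (d - 2) * N.*2.+1 ^ (d - 4) * (64 ^ 2 * 9 * N.*2.+1 ^ 2 * L ^ 4))%N.
Proof.
move=> Nlam N0 d4 NL; set P := N.*2.+1; set r := size _.
set B := (64 ^ 2 * 9 * P ^ 2 * L ^ 4)%N.
pose box n : seq 'rV[int]_d := [seq boxvec (n := n) f | f <- enum predT].
have ubox n : uniq (box n) by rewrite map_inj_uniq ?enum_uniq//; exact: boxvec_inj.
have sbox n : size (box n) = (n.*2.+1 ^ d)%N.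
  by rewrite size_map -cardT card_ffun !card_ord.
have := incidence_le Nlam N0 d4 NL (ubox N) (ubox N.*2).
rewrite !sbox -/P -/B => inc.
have lo : (r * P ^ d <= \sum_(x <- box N) \sum_(y <- box N.*2) (normsq (x - y)%R == lam%:Z))%N.
  rewrite -sbox mulnC -[X in (X * _)%N]count_predT -sum1_count big_distrl/=.
  rewrite big_seq [leqRHS]big_seq; apply: leq_sum => x /mapP[f _ ->].
  rewrite mul1n sum_nat_of_bool /r -(size_map (fun u => boxvec f - u) (sphere d lam)).
  apply: uniq_leq_size.
    by rewrite map_inj_uniq ?sphere_uniq// => u v /addrI/oppr_inj.
  move=> y /mapP[u]; rewrite mem_sphere => uS ->.
  rewrite mem_filter opprB addrC subrK uS/=.
  have /inboxP[g ->] : inbox N.*2 (boxvec f - u).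
    apply/forallP => c; have /forallP/(_ c) := boxvec_inbox f.
    have /andP[_ /normsq_inbox/(_ (eqP uS))/forallP/(_ c)] := Nlam.
    by rewrite !mxE; move: (u 0 c) (nat_of_ord (f c)); clear; lia.
  by apply: map_f; rewrite mem_enum.
have d0 : (0 < d)%N by apply: leq_trans d4.
have P0 : (0 < P)%N by [].
have : (r * P ^ d <= 2 ^ (d - 2) * P ^ (d - 4) * B * P ^ d)%N; last first.
  by rewrite leq_pmul2r ?expn_gt0.
rewrite -(@leq_exp2r _ _ d)//.
apply: (leq_trans _ (leq_trans inc _)); first by rewrite leq_exp2r.
have -> : (2 ^ (d - 2) * P ^ (d - 4) * B * P ^ d =
           (2 * P ^ 2) ^ (d - 2) * B)%N.
  rewrite expnMn -expnM [(2 ^ _ * _ * B * _)%N]mulnAC -[(2 ^ _ * _ * _)%N]mulnA -expnD.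
  by congr (_ * P ^ _ * _)%N; lia.
rewrite [leqRHS]expnMn leq_mul2r; apply/orP; right.
rewrite -[((_ ^ (d - 2)) ^ d)%N]expnM [((d - 2) * d)%N]mulnC expnM.
rewrite leq_exp2r; last by lia.
rewrite expnMn -[((P ^ 2) ^ d)%N]expnM [(2 * d)%N]mulnC expnM -mulnn mulnCA.
by rewrite leq_mul2l -expnMn leq_exp2r// /P; apply/orP; right; lia.
Qed.

(** * Scaling in lam *)

Lemma bernoulli_le (R : realDomainType) (x : R) n :
  0 <= x -> 1 + n%:R * x <= (1 + x) ^+ n.
Proof.
move=> x0; elim: n => [|n IH]; first by rewrite mul0r addr0 expr0.
rewrite exprS -natr1.
have : 0 <= n%:R * x * x by rewrite !mulr_ge0.
have : (1 + x) * (1 + n%:R * x) <= (1 + x) * (1 + x) ^+ n.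
  by rewrite ler_wpM2l// addr_ge0.
lra.
Qed.

(** Powers of logarithms are absorbed by any positive power of lam. *)
Lemma polylog_le (R : realType) (e m : nat) (eps : R) : 0 < eps ->
  exists2 C : R, 0 < C & forall l lam : nat, (0 < lam)%N ->
    (2 ^ l <= (3 * lam) ^ e)%N -> l.+1%:R ^+ m <= C * lam%:R `^ eps.
Proof.
move=> eps0; pose eta := eps / (e * m).+1%:R.
have eta0 : 0 < eta by rewrite divr_gt0.
pose x : R := 2 `^ eta - 1.
have x0 : 0 < x.
  have p1 : 1 `^ eta = 1 :> R by rewrite powR1.
  rewrite subr_gt0 -[ltLHS]p1 gt0_ltr_powR// ?nnegrE ?ler01//; lra.
exists ((1 + x^-1) ^+ m * 3 `^ eps).
  by rewrite mulr_gt0 ?powR_gt0// exprn_gt0// addr_gt0 ?invr_gt0.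
move=> l lam lam0 le_l.
have lam1 : 1 <= (3 * lam)%:R :> R by rewrite (ler_nat _ 1) muln_gt0.
have cx0 : 0 <= 1 + x^-1 by rewrite addr_ge0// invr_ge0 ltW.
have step : l.+1%:R <= (1 + x^-1) * (3 * lam)%:R `^ (e%:R * eta).
  apply: (@le_trans _ _ ((1 + x^-1) * (1 + l%:R * x))).
    have -> : (1 + x^-1) * (1 + l%:R * x) = 1 + l%:R * x + x^-1 + l%:R.
      by field; rewrite gt_eqF.
    rewrite -natr1.
    have : 0 < x^-1 by rewrite invr_gt0.
    have : 0 <= l%:R * x by rewrite mulr_ge0// ltW.
    lra.
  rewrite ler_wpM2l//.
  apply: le_trans (bernoulli_le _ (ltW x0)) _.
  rewrite /x addrCA subrr addr0 -powR_mulrn ?powR_ge0// -powRrM mulrC powRrM.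
  rewrite powRrM !powR_mulrn// ge0_ler_powR ?nnegrE ?exprn_ge0 ?(ltW eta0)//.
  by rewrite -!natrX ler_nat.
apply: (@le_trans _ _ (((1 + x^-1) * (3 * lam)%:R `^ (e%:R * eta)) ^+ m)).
  by rewrite lerXn2r ?nnegrE// mulr_ge0 ?powR_ge0.
rewrite exprMn -mulrA ler_wpM2l ?exprn_ge0//.
rewrite -powR_mulrn ?powR_ge0// -powRrM -powRM// -natrM ler_powR//.
have -> : e%:R * eta * m%:R = (e * m)%:R / (e * m).+1%:R * eps.
  by rewrite /eta natrM; ring.
by rewrite ler_piMl ?(ltW eps0)// ler_pdivrMr// mul1r ler_nat.
Qed.

Lemma sqrt_bracket n : exists m, (m ^ 2 <= n < m.+1 ^ 2)%N.
Proof.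
have ex : exists m, (m ^ 2 <= n)%N by exists 0%N.
have bd m : (m ^ 2 <= n)%N -> (m <= n)%N.
  by apply: leq_trans; case: m => // m; rewrite -mulnn leq_pmull.
case: (ex_maxnP ex bd) => m mn mmax; exists m; rewrite mn/= ltnNge.
by apply/negP => /mmax; rewrite ltnn.
Qed.

Lemma shell_scale_bounds (R : realType) (d : nat) (eps : R) :
  (4 <= d)%N -> 0 < eps ->
  exists2 C : R, 1 <= C & forall lam, (0 < lam)%N ->
    (size (sphere d lam))%:R <= C * lam%:R `^ (d%:R / 2 - 1 + eps) /\
    forall F G : seq 'rV[int]_d, uniq F -> uniq G ->
    (\sum_(x <- G) shell_count lam F x)%:R <=
    C * lam%:R `^ (1 + eps) * (size G * size F)%:R `^ (1 - 2 / d%:R).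
Proof.
move=> d4 eps0; have [C1 C10 C1P] := @polylog_le R 1 4 eps eps0.
pose c0 : R := (64 ^ 2 * 9 * 9)%:R.
pose c1 : R := (2 ^ (d - 2) * 3 ^ (d - 4))%:R.
have c1_ge1 : 1 <= c1 by rewrite (ler_nat _ 1) muln_gt0 !expn_gt0.
have c0_ge1 : 1 <= c0 by rewrite (ler_nat _ 1).
have c0C1 : 0 < c0 * C1 by rewrite mulr_gt0// (lt_le_trans ltr01).
exists (1 + c1 * (c0 * C1)).
  by rewrite lerDl mulr_ge0 ?(ltW c0C1)// (le_trans ler01).
move=> lam lam0; have [N /[dup] Nlam /andP[Nle Ngt]] := sqrt_bracket lam.
have N0 : (0 < N)%N by case: N Nle Ngt Nlam => //; lia.
pose l := trunc_log 2 N.*2.+1.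
have lP : (2 ^ l.+1.-1 <= N.*2.+1 < 2 ^ l.+1)%N by rewrite trunc_logP// trunc_log_ltn.
have P3 : (N.*2.+1 <= 3 * N)%N by lia.
pose B := (64 ^ 2 * 9 * N.*2.+1 ^ 2 * l.+1 ^ 4)%N.
have lam_pos : 0 < lam%:R :> R by rewrite ltr0n.
have BE : (B%:R : R) <= c0 * C1 * lam%:R `^ (1 + eps).
  apply: (@le_trans _ _ (c0 * lam%:R * (l.+1%:R ^+ 4))).
    rewrite /c0 -natrX -!natrM ler_nat /B leq_mul2r; apply/orP; right.
    rewrite -[X in (_ <= X)%N]mulnA; apply: leq_mul => //.
    by move: P3 Nle; clear; nia.
  rewrite powRD ?(gt_eqF lam_pos) ?implybT// powRr1 ?ler0n//.
  rewrite -!mulrA ler_wpM2l// [leRHS]mulrCA ler_wpM2l//; apply: C1P => //.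
  case/andP: lP => lP _; apply: leq_trans lP _; apply: leq_trans P3 _.
  by rewrite expn1 leq_mul2l/=; apply: leq_trans Nle; rewrite -mulnn leq_pmull.
split.
  apply: (@le_trans _ _ (c1 * lam%:R `^ ((d - 4)%:R / 2) * (c0 * C1 * lam%:R `^ (1 + eps)))); last first.
    rewrite mulrACA -powRD ?(gt_eqF lam_pos) ?implybT//.
    have -> : (d - 4)%:R / 2 + (1 + eps) = d%:R / 2 - 1 + eps :> R.
      by rewrite natrB//; field.
    by rewrite ler_wpM2r ?powR_ge0// lerDr.
  apply: (@le_trans _ _ ((2 ^ (d - 2) * N.*2.+1 ^ (d - 4))%:R * B%:R)).
    by rewrite -natrM ler_nat; exact: size_sphere_le.
  apply: ler_pM => //; rewrite /c1 !natrM -mulrA ler_wpM2l//.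
  apply: (@le_trans _ _ (((3 * N) ^ (d - 4))%:R)).
    by rewrite ler_nat; case: (d - 4)%N => [|e]; rewrite ?expn0// leq_exp2r.
  rewrite expnMn natrM ler_wpM2l//.
  have -> : (d - 4)%:R / 2 = 2^-1 * (d - 4)%:R :> R by rewrite mulrC.
  rewrite powRrM powR_mulrn ?powR_ge0// natrX lerXn2r ?nnegrE ?powR_ge0//.
  rewrite powR12_sqrt// -[leLHS]ger0_norm// -sqrtr_sqr ler_sqrt//.
  by rewrite -natrX ler_nat.
move=> F G uF uG.
have inc := incidence_le Nlam N0 d4 lP uG uF.
under eq_bigr do rewrite shell_countE//.
set Q := (\sum_(x <- G) _)%N in inc *; set n := (size G * size F)%N in inc *.
have d0 : (0 < d)%N by apply: leq_trans d4.
have dr0 : (d%:R : R) != 0 by rewrite pnatr_eq0 -lt0n.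
apply: (@le_trans _ _ (B%:R * n%:R `^ (1 - 2 / d%:R))).
  rewrite -(ler_pXn2r d0) ?nnegrE ?mulr_ge0 ?powR_ge0//.
  rewrite exprMn -[_ `^ _ ^+ d]powR_mulrn ?powR_ge0// -powRrM.
  have -> : (1 - 2 / d%:R) * d%:R = (d - 2)%:R :> R.
    by rewrite mulrBl mul1r divfK// natrB//; apply: leq_trans d4.
  by rewrite powR_mulrn// -!natrX -natrM ler_nat mulnC.
rewrite ler_wpM2r ?powR_ge0//; apply: le_trans BE _.
rewrite ler_wpM2r ?powR_ge0//.
have : c0 * C1 <= c1 * (c0 * C1) by rewrite ler_peMl// ltW.
lra.
Qed.

(** * Indicator functions *)

(** Weighted geometric mean of the four bounds on a level T = ln tau, written
additively: T is bounded by the size of a sphere, by the size of F, by the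
total mass of the shell counts, and by the incidence bound. *)
Lemma log_interpolation (R : realFieldType) (w1 w2 w3 w4 c l T nu ga rho kap v : R) :
  0 <= w1 -> 0 <= w2 -> 0 <= w3 -> 0 <= w4 -> w1 + w2 + w3 + w4 = 1 ->
  0 <= c ->
  T <= c + rho * l -> T <= nu -> T + ga <= c + rho * l + nu ->
  T + ga <= c + kap * l + (1 - v) * (ga + nu) ->
  T <= c + (rho * (w1 + w3) + kap * w4) * l
       + (w2 + w3 + (1 - v) * w4) * nu - (w3 + v * w4) * ga.
Proof.
move=> w10 w20 w30 w40 w_sum c0 h1 h2 h3 h4.
have e1 := ler_wpM2l w10 h1; have e2 := ler_wpM2l w20 h2.
have e3 := ler_wpM2l w30 h3; have e4 := ler_wpM2l w40 h4.
have e5 := mulr_ge0 w20 c0.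
have -> : T = (w1 + w2 + w3 + w4) * T by rewrite w_sum mul1r.
have -> : c = (w1 + w2 + w3 + w4) * c by rewrite w_sum mul1r.
nra.
Qed.

(** On a common set G where the i-th shell count is at least tau i, each tau i
is bounded by the geometric mean of the four basic bounds with weights
w1 i, ..., w4 i. Each mean brings a negative power of |G|, and the hypothesis
on the weights says that altogether they absorb the factor |G|. *)
Lemma level_set_bound (R : realType) (d k : nat) (w1 w2 w3 w4 : nat -> R)
    (rho kap C : R) (lam : nat) (G : seq 'rV[int]_d) (F : nat -> seq 'rV[int]_d)
    (tau : nat -> nat) :
  (forall i, (i < k)%N -> [/\ 0 <= w1 i, 0 <= w2 i, 0 <= w3 i, 0 <= w4 i &
     w1 i + w2 i + w3 i + w4 i = 1]) ->
  1 <= \sum_(i < k) (w3 i + 2 / d%:R * w4 i) ->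
  1 <= C -> (0 < lam)%N ->
  (size (sphere d lam))%:R <= C * lam%:R `^ rho ->
  (forall F G : seq 'rV[int]_d, uniq F -> uniq G ->
    (\sum_(x <- G) shell_count lam F x)%:R <=
    C * lam%:R `^ kap * (size G * size F)%:R `^ (1 - 2 / d%:R)) ->
  uniq G -> (0 < size G)%N -> (forall i, uniq (F i)) ->
  (forall i, (i < k)%N -> (0 < tau i)%N) ->
  (forall i x, (i < k)%N -> x \in G -> (tau i <= shell_count lam (F i) x)%N) ->
  (size G)%:R * \prod_(i < k) (tau i)%:R <=
  C ^+ k * lam%:R `^ (\sum_(i < k) (rho * (w1 i + w3 i) + kap * w4 i)) *
  \prod_(i < k) (size (F i))%:R `^ (w2 i + w3 i + (1 - 2 / d%:R) * w4 i).
Proof.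
move=> wP sum_b C1 lam0 rP incP uG G0 uF tau0 tauU.
have Cp : 0 < C by apply: lt_le_trans C1.
have lamp : 0 < lam%:R :> R by rewrite ltr0n.
have Gp : 0 < (size G)%:R :> R by rewrite ltr0n.
have [x0 x0G] : exists x0, x0 \in G.
  by case: (G) G0 => // x s _; exists x; rewrite mem_head.
have Fp i : (i < k)%N -> (0 < size (F i))%N.
  move=> ik; apply: leq_trans (tau0 _ ik) _; apply: leq_trans (tauU _ _ ik x0G) _.
  exact: shell_count_le_size.
have Fpr i : (i < k)%N -> 0 < (size (F i))%:R :> R by move=> ik; rewrite ltr0n Fp.
have tp i : (i < k)%N -> 0 < (tau i)%:R :> R by move=> ik; rewrite ltr0n tau0.
pose l := ln (lam%:R : R); pose c := ln C; pose ga := ln ((size G)%:R : R).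
pose T i := ln ((tau i)%:R : R); pose nu i := ln ((size (F i))%:R : R).
have lnpow (a x : R) : 0 < a -> a `^ x = expR (x * ln a).
  by move=> a0; rewrite /powR gt_eqF.
have c0 : 0 <= c by rewrite ln_ge0.
have ga0 : 0 <= ga by rewrite ln_ge0// (ler_nat _ 1).
have tG i : (i < k)%N ->
    (tau i * size G <= \sum_(x <- G) shell_count lam (F i) x)%N.
  move=> ik; rewrite -[X in (_ * X)%N]count_predT -sum1_count big_distrr/=.
  by rewrite big_seq [leqRHS]big_seq; apply: leq_sum => x xG; rewrite muln1 tauU.
have T_le i : (i < k)%N -> T i <= c + (rho * (w1 i + w3 i) + kap * w4 i) * l
     + (w2 i + w3 i + (1 - 2 / d%:R) * w4 i) * nu i - (w3 i + 2 / d%:R * w4 i) * ga.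
  move=> ik; have [w10 w20 w30 w40 ws] := wP _ ik.
  have lnC (y : R) : ln (C * lam%:R `^ y) = c + y * l.
    by rewrite lnM ?posrE ?powR_gt0// ln_powR.
  have Cl0 (y : R) : 0 < C * lam%:R `^ y by rewrite mulr_gt0 ?powR_gt0.
  have lnTG : ln ((tau i * size G)%:R : R) = T i + ga.
    by rewrite natrM lnM ?posrE ?tp.
  have TGp : 0 < (tau i * size G)%:R :> R by rewrite natrM mulr_gt0 ?tp.
  apply: log_interpolation => //.
  - rewrite -lnC ler_ln ?posrE ?tp//; apply: le_trans rP; rewrite ler_nat.
    by apply: leq_trans (tauU _ _ ik x0G) _; exact: shell_count_le_sphere.
  - rewrite ler_ln ?posrE ?tp ?Fpr// ler_nat.
    by apply: leq_trans (tauU _ _ ik x0G) _; exact: shell_count_le_size.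
  - rewrite -lnC -lnTG -lnM ?posrE ?Fpr// ler_ln ?posrE ?mulr_gt0 ?Fpr ?powR_gt0//.
    apply: (@le_trans _ _ ((size (F i) * size (sphere d lam))%:R)).
      by rewrite ler_nat; apply: leq_trans (tG _ ik) _; exact: sum_shell_count_le.
    by rewrite natrM mulrC ler_wpM2r.
  - have -> : c + kap * l + (1 - 2 / d%:R) * (ga + nu i) =
      ln (C * lam%:R `^ kap * (size G * size (F i))%:R `^ (1 - 2 / d%:R)).
      rewrite lnM ?posrE ?powR_gt0// ?natrM ?mulr_gt0 ?Fpr// lnC ln_powR.
      by rewrite lnM ?posrE ?Fpr.
    rewrite -lnTG ler_ln ?posrE ?mulr_gt0 ?powR_gt0 ?natrM ?mulr_gt0 ?Fpr ?tp//.
    rewrite -!natrM; apply: le_trans (incP _ _ (uF i) uG).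
    by rewrite ler_nat tG.
have -> : (size G)%:R * \prod_(i < k) (tau i)%:R = expR (ga + \sum_(i < k) T i).
  rewrite expRD expR_sum lnK ?posrE//; congr (_ * _); apply: eq_bigr => i _.
  by rewrite lnK// posrE tp.
have -> : C ^+ k * lam%:R `^ (\sum_(i < k) (rho * (w1 i + w3 i) + kap * w4 i)) *
  \prod_(i < k) (size (F i))%:R `^ (w2 i + w3 i + (1 - 2 / d%:R) * w4 i) =
  expR (c *+ k + (\sum_(i < k) (rho * (w1 i + w3 i) + kap * w4 i)) * l +
     \sum_(i < k) (w2 i + w3 i + (1 - 2 / d%:R) * w4 i) * nu i).
  rewrite !expRD expR_sum -lnXn// lnK ?posrE ?exprn_gt0//.
  by rewrite -lnpow//; congr (_ * _); apply: eq_bigr => i _; rewrite lnpow// Fpr.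
rewrite ler_expR.
have sumT : \sum_(i < k) T i <= \sum_(i < k)
   (c + (rho * (w1 i + w3 i) + kap * w4 i) * l
     + (w2 i + w3 i + (1 - 2 / d%:R) * w4 i) * nu i - (w3 i + 2 / d%:R * w4 i) * ga).
  by apply: ler_sum => i _; exact: T_le.
rewrite sumrB 2!big_split/= -!mulr_suml sumr_const card_ord in sumT.
have := ler_wpM2r ga0 sum_b; rewrite mul1r; move: sumT.
lra.
Qed.

(** A shell count is an integer at most size (sphere d lam), so there are only
logarithmically many dyadic levels, and the logarithms are absorbed because
the exponent e is not optimal. *)
Lemma restricted_bound (R : realType) (d k : nat) (w1 w2 w3 w4 : nat -> R) (e : R) :
  (4 <= d)%N ->
  (forall i, (i < k)%N -> [/\ 0 <= w1 i, 0 <= w2 i, 0 <= w3 i, 0 <= w4 i &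
     w1 i + w2 i + w3 i + w4 i = 1]) ->
  1 <= \sum_(i < k) (w3 i + 2 / d%:R * w4 i) ->
  \sum_(i < k) ((d%:R / 2 - 1) * (w1 i + w3 i) + w4 i) < e ->
  exists2 C : R, 0 < C &
  forall (lam : nat) (G : seq 'rV[int]_d) (F : nat -> seq 'rV[int]_d),
  (0 < lam)%N -> uniq G -> (forall i, uniq (F i)) ->
  \sum_(x <- G) \prod_(i < k) (shell_count lam (F i) x)%:R <=
  C * lam%:R `^ e *
  \prod_(i < k) (size (F i))%:R `^ (w2 i + w3 i + (1 - 2 / d%:R) * w4 i).
Proof.
move=> d4 wP sum_b cost.
set e0 := \sum_(i < k) _ in cost.
pose eps := (e - e0) / k.+1%:R.
have eps0 : 0 < eps by rewrite divr_gt0// subr_gt0.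
have [C C1 CP] := shell_scale_bounds d4 eps0.
have [Cp Cp0 CpP] := @polylog_le R d k eps eps0.
exists (Cp * (2 ^+ k * C ^+ k)).
  by rewrite !mulr_gt0 ?exprn_gt0// (lt_le_trans ltr01).
move=> lam G F lam0 uG uF.
have [rP incP] := CP _ lam0.
set al := fun i => w2 i + w3 i + (1 - 2 / d%:R) * w4 i.
set rhs := \prod_(i < k) _.
have rhs0 : 0 <= rhs by apply: prodr_ge0 => i _; exact: powR_ge0.
set r := size (sphere d lam) in rP.
pose K := (trunc_log 2 r).+1.
pose U i x := shell_count lam (F i) x.
pose G' := [seq x <- G | [forall i : 'I_k, 0 < U i x]%N].
have uG' : uniq G' by rewrite filter_uniq.
have UG' x (i : 'I_k) : x \in G' -> (0 < U i x)%N.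
  by rewrite mem_filter => /andP[/forallP/(_ i)].
have -> : \sum_(x <- G) \prod_(i < k) (shell_count lam (F i) x)%:R =
   \sum_(x <- G') \prod_(i < k) (U i x)%:R :> R.
  rewrite big_filter [RHS]big_mkcond/=; apply: eq_bigr => x _.
  case: ifPn => //; rewrite negb_forall => /existsP[i0].
  rewrite -eqn0Ngt => /eqP Ui.
  by rewrite (bigD1 i0)//= -/(U i0 x) Ui mul0r.
pose J x : {ffun 'I_k -> 'I_K} := [ffun i : 'I_k => inord (trunc_log 2 (U i x))].
have JE x i : (J x i = trunc_log 2 (U i x) :> nat)%N.
  by rewrite ffunE inordK// ltnS leq_trunc_log// shell_count_le_sphere.
rewrite (partition_big J xpredT)//=.
set e1 := \sum_(i < k) ((d%:R / 2 - 1 + eps) * (w1 i + w3 i) + (1 + eps) * w4 i).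
have each (j : {ffun 'I_k -> 'I_K}) : true ->
   \sum_(x <- G' | J x == j) \prod_(i < k) (U i x)%:R <=
   2 ^+ k * C ^+ k * lam%:R `^ e1 * rhs.
  move=> _; rewrite -big_filter; set Gj := [seq x <- G' | _].
  have [/size0nil->|Gj0] := posnP (size Gj).
    rewrite big_nil !mulr_ge0 ?exprn_ge0 ?powR_ge0//.
    by rewrite (le_trans ler01).
  pose tau i : nat := if insub i is Some i' then (2 ^ j i')%N else 1%N.
  have tauE (i : 'I_k) : tau i = (2 ^ j i)%N by rewrite /tau valK.
  apply: (@le_trans _ _ (2 ^+ k * ((size Gj)%:R * \prod_(i < k) (tau i)%:R))); last first.
    rewrite -!mulrA ler_wpM2l// mulrA.
    apply: (level_set_bound wP sum_b C1 lam0 rP incP) => //.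
    - by rewrite filter_uniq.
    - by move=> i ik; rewrite (tauE (Ordinal ik)) expn_gt0.
    - move=> i x ik; rewrite mem_filter => /andP[/eqP Jx xG'].
      by rewrite (tauE (Ordinal ik)) -Jx JE trunc_logP// UG'.
  apply: (@le_trans _ _ (\sum_(x <- Gj) 2 ^+ k * \prod_(i < k) (tau i)%:R)); last first.
    by rewrite big_const_seq iter_addr_0 count_predT -[leLHS]mulr_natl mulrCA.
  rewrite big_seq [leRHS]big_seq; apply: ler_sum => x.
  rewrite mem_filter => /andP[/eqP Jx xG'].
  rewrite -[k in 2 ^+ k]card_ord -prodr_const -big_split/=.
  apply: ler_prod => i _; rewrite ler0n/= tauE -natrM ler_nat -expnS -Jx JE.
  by rewrite ltnW// trunc_log_ltn.
apply: le_trans (ler_sum _ each) _.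
rewrite sumr_const card_ffun !card_ord -[leLHS]mulr_natl natrX.
have KP : K%:R ^+ k <= Cp * lam%:R `^ eps.
  apply: CpP => //.
  have [r0|r0] := posnP r.
    by rewrite r0 trunc_log0 expn0 expn_gt0 muln_gt0 lam0.
  apply: (@leq_trans r); first by rewrite trunc_logP.
  rewrite /r size_filter; apply: leq_trans (count_size _ _) _.
  rewrite size_map -cardT card_ffun !card_ord.
  rewrite leq_exp2r; first by move: lam0; clear; lia.
  exact: leq_trans d4.
have lamp : 0 < lam%:R :> R by rewrite ltr0n.
have lam1 : 1 <= lam%:R :> R by rewrite (ler_nat _ 1).
have exps : lam%:R `^ eps * lam%:R `^ e1 <= lam%:R `^ e.
  rewrite -powRD ?(gt_eqF lamp) ?implybT// ler_powR//.
  have : e1 <= e0 + k%:R * eps.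
    have -> : k%:R * eps = \sum_(i < k) eps by rewrite sumr_const card_ord mulr_natl.
    rewrite /e1 /e0 -big_split/=.
    apply: ler_sum => i _; have [w10 w20 w30 w40 ws] := wP _ (ltn_ord i).
    have := ltW eps0; move: ws w20; clear; nra.
  have : e = e0 + (k%:R + 1) * eps by rewrite natr1 mulrC divfK ?pnatr_eq0// addrC subrK.
  lra.
have cst0 : 0 <= 2 ^+ k * C ^+ k by rewrite mulr_ge0 ?exprn_ge0// (le_trans ler01).
rewrite [leLHS]mulrA ler_wpM2r//.
apply: (@le_trans _ _ (Cp * lam%:R `^ eps * (2 ^+ k * C ^+ k * lam%:R `^ e1))).
  by rewrite ler_wpM2r// mulr_ge0// powR_ge0.
by rewrite mulrACA ler_wpM2l// mulr_ge0// ltW.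
Qed.

(** * From indicator functions to functions *)

Lemma sum_geometric_le (R : realFieldType) (x : R) n : 0 <= x < 1 ->
  \sum_(j < n) x ^+ j <= (1 - x)^-1.
Proof.
move=> /andP[x0 x1]; have x1' : 0 < 1 - x by rewrite subr_gt0.
rewrite -[leRHS]mul1r ler_pdivlMr// mulrC.
have -> : (1 - x) * \sum_(j < n) x ^+ j = 1 - x ^+ n.
  by rewrite -opprB mulNr -subrX1 opprB.
by rewrite gerBl exprn_ge0.
Qed.

(** Decompose f / A into dyadic layers F_j, where f is about 2^-j A and
|F_j| <= 2^((j+1) q). On a counting space f / A is at most 1, so only j >= 0
occurs, and the condition al * q < 1 makes the sum over j a convergent
geometric series. *)
Lemma restricted_to_strong (R : realType) (al q : R) :
  0 < q -> 0 <= al -> al * q < 1 ->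
  exists2 C : R, 0 < C &
  forall (J L : eqType) (s : seq J) (w : J -> R) (g : J -> L)
    (B A : R) (f : L -> R),
  (forall t, 0 <= w t) -> (forall y, 0 <= f y) -> 0 <= A -> 0 <= B ->
  (forall F : seq L, uniq F ->
     \sum_(t <- s) w t * (g t \in F)%:R <= B * (size F)%:R `^ al) ->
  (forall Y : seq L, uniq Y -> \sum_(y <- Y) f y `^ q <= A `^ q) ->
  \sum_(t <- s) w t * f (g t) <= C * B * A.
Proof.
move=> q0 al0 alq; pose x : R := 2 `^ (al * q - 1).
have x01 : 0 <= x < 1.
  rewrite powR_ge0/= /x -[ltRHS](powRr0 2) /powR (gt_eqF (ltr0Sn _ 1)).
  by rewrite ltr_expR mul0r pmulr_llt0 ?subr_lt0// ln_gt0// (ltr_nat _ 1 2).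
exists (2 `^ (al * q) * (1 - x)^-1 + 1).
  rewrite ltr_wpDl// mulr_ge0 ?powR_ge0 ?invr_ge0 ?subr_ge0//.
  by case/andP: x01 => _ /ltW.
move=> J L s w g B A f w0 f0 A0 B0 restr norm.
have [Az|Anz] := eqVneq A 0.
  rewrite Az mulr0 big1// => t _.
  have := norm [:: g t] isT; rewrite big_seq1 Az powR0 ?gt_eqF// => fq.
  have : f (g t) `^ q == 0 by rewrite eq_le fq powR_ge0.
  by rewrite powR_eq0 => /andP[/eqP-> _]; rewrite mulr0.
have {A0 Anz}A0 : 0 < A by rewrite lt_def Anz.
have fA y : f y <= A.
  have := norm [:: y] isT; rewrite big_seq1 => fq.
  rewrite leNgt; apply/negP => Af.
  have := @gt0_ltr_powR _ _ q0 A (f y); rewrite !nnegrE (ltW A0) f0.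
  by move=> /(_ isT isT Af); rewrite ltNge fq.
pose Y := undup (map g s).
pose F j := [seq y <- Y | 2^-1 ^+ j.+1 * A < f y].
have h2 j : (0 : R) < 2^-1 ^+ j by rewrite exprn_gt0// invr_gt0.
have Fj j : (size (F j))%:R `^ al <= 2 `^ (al * q) * (2 `^ (al * q)) ^+ j.
  have : (size (F j))%:R * (2^-1 ^+ j.+1 * A) `^ q <= A `^ q.
    apply: (@le_trans _ _ (\sum_(y <- F j) f y `^ q)); last first.
      by apply: norm; rewrite filter_uniq// undup_uniq.
    rewrite mulr_natl -[X in _ *+ X]count_predT -iter_addr_0 -big_const_seq/=.
    rewrite big_seq [leRHS]big_seq; apply: ler_sum => y.
    rewrite mem_filter => /andP[/ltW yF _]; apply: ge0_ler_powR => //.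
    - exact: ltW.
    - by rewrite nnegrE mulr_ge0// ltW.
    - by rewrite nnegrE.
  rewrite powRM ?(ltW (h2 _)) ?(ltW A0)// mulrA -[leRHS]mul1r ler_pM2r ?powR_gt0// => sz.
  have {}sz : (size (F j))%:R <= (2 ^+ j.+1) `^ q :> R.
    move: sz; rewrite exprVn -powR_inv1 ?exprn_ge0// -powRrM mulN1r powRN.
    by rewrite ler_pdivrMr ?mul1r// powR_gt0// exprn_gt0.
  apply: le_trans (ge0_ler_powR al0 _ _ sz) _; rewrite ?nnegrE ?powR_ge0//.
  rewrite -exprS -(powR_mulrn j.+1 (ler0n R 2)).
  rewrite -(powR_mulrn j.+1 (powR_ge0 2 (al * q))) -!powRrM.
  by rewrite le_eqVlt; apply/orP; left; apply/eqP; congr (_ `^ _); ring.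
have fle y n : y \in Y ->
    f y <= \sum_(j < n) 2^-1 ^+ j * A * (y \in F j)%:R + 2^-1 ^+ n * A.
  move=> yY; elim: n => [|n IH]; first by rewrite big_ord0 add0r expr0 mul1r.
  have [yF|yF] := ltP (2^-1 ^+ n.+1 * A) (f y).
    rewrite big_ord_recr/= mem_filter yF yY mulr1.
    by apply: le_trans IH _; rewrite lerDl mulr_ge0// ltW.
  apply: le_trans yF _; rewrite lerDr; apply: sumr_ge0 => j _.
  by rewrite !mulr_ge0 ?(ltW A0)// ltW.
(* n is so large that the remainder 2^-n A costs at most B A, even when it is summed over all of Y. *)
pose n := Num.bound ((size Y)%:R `^ al : R).
have nP : (size Y)%:R `^ al <= 2 ^+ n :> R.
  apply: (@le_trans _ _ n%:R); last by rewrite -natrX ler_nat ltnW// ltn_expl.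
  by apply/ltW/archi_boundP; rewrite powR_ge0.
apply: (@le_trans _ _ (\sum_(t <- s) w t *
   (\sum_(j < n) 2^-1 ^+ j * A * (g t \in F j)%:R + 2^-1 ^+ n * A * (g t \in Y)%:R))).
  rewrite big_seq [leRHS]big_seq; apply: ler_sum => t ts.
  have tY : g t \in Y by rewrite mem_undup map_f.
  by rewrite ler_wpM2l// tY mulr1 fle.
under eq_bigr do rewrite mulrDr mulr_sumr.
rewrite big_split/= exchange_big/=.
rewrite -mulrA [_ * (B * A)]mulrDl mul1r; apply: lerD.
  apply: (@le_trans _ _ (\sum_(j < n) 2 `^ (al * q) * x ^+ j * (B * A))).
    apply: ler_sum => j _.
    have -> : \sum_(t <- s) w t * (2^-1 ^+ j * A * (g t \in F j)%:R) =
        2^-1 ^+ j * A * \sum_(t <- s) w t * (g t \in F j)%:R.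
      by rewrite mulr_sumr; apply: eq_bigr => t _; rewrite mulrCA.
    apply: (@le_trans _ _ (2^-1 ^+ j * A * (B * (2 `^ (al * q) * (2 `^ (al * q)) ^+ j)))).
      rewrite ler_wpM2l ?mulr_ge0 ?(ltW A0) ?(ltW (h2 j))//.
      apply: le_trans (restr _ _) _; first by rewrite filter_uniq// undup_uniq.
      by rewrite ler_wpM2l.
    have -> : x = 2 `^ (al * q) * 2^-1.
      by rewrite /x powRB ?powRr1// pnatr_eq0 implybT.
    by rewrite exprMn le_eqVlt; apply/orP; left; apply/eqP; ring.
  rewrite -mulr_suml ler_wpM2r ?mulr_ge0 ?(ltW A0)// -mulr_sumr.
  by rewrite ler_wpM2l ?powR_ge0// sum_geometric_le.
have -> : \sum_(t <- s) w t * (2^-1 ^+ n * A * (g t \in Y)%:R) =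
    2^-1 ^+ n * A * \sum_(t <- s) w t * (g t \in Y)%:R.
  by rewrite mulr_sumr; apply: eq_bigr => t _; rewrite mulrCA.
rewrite mulrAC ler_wpM2r ?(ltW A0)//.
apply: (@le_trans _ _ (2^-1 ^+ n * (B * 2 ^+ n))).
  rewrite ler_wpM2l ?(ltW (h2 n))//; apply: le_trans (restr _ (undup_uniq _)) _.
  by rewrite ler_wpM2l.
by rewrite mulrCA exprVn mulVf ?mulr1// expf_neq0.
Qed.

(** The passage from indicators to functions is made in one variable at a time:
when the other functions are fixed the form is linear with nonnegative
coefficients. *)
Lemma strong_bound (R : realType) (d k : nat) (a w1 w2 w3 w4 : nat -> R) (e : R) :
  (4 <= d)%N ->
  (forall i, (i < k)%N -> [/\ 0 <= w1 i, 0 <= w2 i, 0 <= w3 i, 0 <= w4 i &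
     w1 i + w2 i + w3 i + w4 i = 1]) ->
  (forall i, (i < k)%N -> 0 < a i) ->
  (forall i, (i < k)%N -> w2 i + w3 i + (1 - 2 / d%:R) * w4 i < a i) ->
  1 <= \sum_(i < k) (w3 i + 2 / d%:R * w4 i) ->
  \sum_(i < k) ((d%:R / 2 - 1) * (w1 i + w3 i) + w4 i) < e ->
  exists2 C : R, 0 < C &
  forall (lam : nat) (G : seq 'rV[int]_d) (f : nat -> 'rV[int]_d -> R)
    (A : nat -> R), (0 < lam)%N -> uniq G ->
  (forall i, 0 <= A i) -> (forall i y, 0 <= f i y) ->
  (forall i Y, (i < k)%N -> uniq Y ->
     \sum_(y <- Y) f i y `^ (a i)^-1 <= A i `^ (a i)^-1) ->
  \sum_(x <- G) \prod_(i < k) \sum_(u <- sphere d lam) f i (x - u) <=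
  C * lam%:R `^ e * \prod_(i < k) A i.
Proof.
move=> d4 wP a0 al_lt sum_b cost.
pose al i := w2 i + w3 i + (1 - 2 / d%:R) * w4 i.
have al0 i : (i < k)%N -> 0 <= al i.
  move=> ik; have [_ w20 w30 w40 _] := wP _ ik.
  rewrite !addr_ge0// mulr_ge0// subr_ge0 ler_pdivrMr ?ltr0n ?mul1r ?ler_nat; lia.
suff main m : (m <= k)%N -> exists2 C : R, 0 < C &
  forall (lam : nat) (G : seq 'rV[int]_d) (f : nat -> 'rV[int]_d -> R)
    (A : nat -> R) (F : nat -> seq 'rV[int]_d), (0 < lam)%N -> uniq G ->
  (forall i, 0 <= A i) -> (forall i y, 0 <= f i y) -> (forall i, uniq (F i)) ->
  (forall i Y, (i < m)%N -> uniq Y ->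
     \sum_(y <- Y) f i y `^ (a i)^-1 <= A i `^ (a i)^-1) ->
  (forall i, (m <= i < k)%N -> f i =1 (fun y => (y \in F i)%:R)) ->
  (forall i, (m <= i < k)%N -> A i = (size (F i))%:R `^ al i) ->
  \sum_(x <- G) \prod_(i < k) \sum_(u <- sphere d lam) f i (x - u) <=
  C * lam%:R `^ e * \prod_(i < k) A i.
  have [C C0 CP] := main k (leqnn k); exists C => // lam G f A lam0 uG A0 f0 fA.
  apply: (CP lam G f A (fun=> [::])) => //.
  - by move=> i /andP[/leq_ltn_trans h /h]; rewrite ltnn.
  - by move=> i /andP[/leq_ltn_trans h /h]; rewrite ltnn.
elim: m => [_|m IH mk].
  have [C C0 CP] := restricted_bound d4 wP sum_b cost.
  exists C => // lam G f A F lam0 uG A0 f0 uF _ fF AF.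
  have := CP lam G F lam0 uG uF.
  rewrite (eq_bigr (fun x => \prod_(i < k) \sum_(u <- sphere d lam) f i (x - u))); last first.
    move=> x _; apply: eq_bigr => i _; rewrite /shell_count natr_sum.
    by apply: eq_bigr => u _; rewrite fF ?ltn_ord.
  move=> /le_trans; apply; rewrite le_eqVlt; apply/orP; left; apply/eqP.
  by congr (_ * _); apply: eq_bigr => i _; rewrite AF ?ltn_ord.
have [C C0 CP] := IH (ltnW mk).
have am0 := a0 _ mk.
have q0 : 0 < (a m)^-1 by rewrite invr_gt0.
have alq : al m * (a m)^-1 < 1 by rewrite ltr_pdivrMr// mul1r al_lt.
have [D D0 DP] := restricted_to_strong q0 (al0 _ mk) alq.
exists (D * C); first by rewrite mulr_gt0.
move=> lam G f A F lam0 uG A0 f0 uF fA fF AF.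
pose mo := Ordinal mk.
pose W x := \prod_(i < k | i != mo) \sum_(u <- sphere d lam) f i (x - u).
pose PA := \prod_(i < k | i != mo) A i.
pose s := [seq (x, u) | x <- G, u <- sphere d lam].
pose upd T (h : T) (g : nat -> T) i := if i == m then h else g i.
have updE T (h : T) (g : nat -> T) (i : 'I_k) : i != mo -> upd T h g i = g i.
  by move=> /negbTE im; rewrite /upd -[m]/(mo : nat) val_eqE im.
have updm T (h : T) (g : nat -> T) : upd T h g m = h by rewrite /upd eqxx.
have split_form g : \sum_(x <- G) \prod_(i < k) \sum_(u <- sphere d lam) upd _ g f i (x - u)
    = \sum_(t <- s) W t.1 * g (t.1 - t.2).
  rewrite /s big_allpairs; apply: eq_bigr => x _; rewrite (bigD1 mo)//= mulrC.
  rewrite updm mulr_sumr; apply: eq_bigr => u _; congr (_ * _).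
  by apply: eq_bigr => i im; rewrite updE.
have fupd : f = upd _ (f m) f.
  by apply: funext => i; rewrite /upd; case: eqP => // ->.
rewrite {1}fupd split_form (bigD1 mo)//= -/PA.
have PA0 : 0 <= PA by exact: prodr_ge0.
have -> : D * C * lam%:R `^ e * (A m * PA) = D * (C * lam%:R `^ e * PA) * A m by ring.
apply: DP => //.
- by move=> t; apply: prodr_ge0 => i _; apply: sumr_ge0.
- by rewrite !mulr_ge0 ?powR_ge0// ltW.
- move=> F0 uF0; rewrite -(split_form (fun y => (y \in F0)%:R)).
  have := CP lam G (upd _ (fun y => (y \in F0)%:R) f)
    (upd _ ((size F0)%:R `^ al m) A) (upd _ F0 F) lam0 uG.
  have -> : \prod_(i < k) upd _ ((size F0)%:R `^ al m) A i = (size F0)%:R `^ al m * PA.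
    rewrite (bigD1 mo)//= updm; congr (_ * _).
    by apply: eq_bigr => i im; rewrite updE.
  rewrite [_ * PA]mulrC mulrA; apply.
  + by move=> i; rewrite /upd; case: ifP => _; rewrite ?powR_ge0.
  + by move=> i y; rewrite /upd; case: ifP.
  + by move=> i; rewrite /upd; case: ifP.
  + move=> i Y im uY; rewrite /upd (ltn_eqF im); apply: fA => //.
    exact: ltnW.
  + move=> i /andP[mi ik] y; rewrite /upd; case: eqP => // /eqP im.
    by rewrite fF// ik andbT ltn_neqAle eq_sym im.
  + move=> i /andP[mi ik]; rewrite /upd; case: eqP => [->//|/eqP im].
    by rewrite AF// ik andbT ltn_neqAle eq_sym im.
- by move=> Y uY; exact: fA.
Qed.

(** The strict inequality of the previous statement is obtained by mixing the
weights with a small amount eta of those of the point (a/2, a/2) on the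
diagonal: this lowers the exponents strictly, keeps the condition on the sum
of the b's because the a's add up to at least 2, and costs an arbitrarily
small power of lam. *)
Lemma multilinear_sphere_bound (R : realType) (d k : nat)
    (a w1 w2 w3 w4 : nat -> R) (e : R) :
  (4 <= d)%N ->
  (forall i, (i < k)%N -> [/\ 0 <= w1 i, 0 <= w2 i, 0 <= w3 i, 0 <= w4 i &
     w1 i + w2 i + w3 i + w4 i = 1]) ->
  (forall i, (i < k)%N -> 0 < a i <= 1) ->
  (forall i, (i < k)%N -> w2 i + w3 i + (1 - 2 / d%:R) * w4 i <= a i) ->
  2 <= \sum_(i < k) a i ->
  1 <= \sum_(i < k) (w3 i + 2 / d%:R * w4 i) ->
  \sum_(i < k) ((d%:R / 2 - 1) * (w1 i + w3 i) + w4 i) < e ->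
  exists2 C : R, 0 < C &
  forall (lam : nat) (G : seq 'rV[int]_d) (f : nat -> 'rV[int]_d -> R)
    (A : nat -> R), (0 < lam)%N -> uniq G ->
  (forall i, 0 <= A i) -> (forall i y, 0 <= f i y) ->
  (forall i Y, (i < k)%N -> uniq Y ->
     \sum_(y <- Y) f i y `^ (a i)^-1 <= A i `^ (a i)^-1) ->
  \sum_(x <- G) \prod_(i < k) \sum_(u <- sphere d lam) f i (x - u) <=
  C * lam%:R `^ e * \prod_(i < k) A i.
Proof.
move=> d4 wP a01 al_le sum_a sum_b cost.
set e0 := \sum_(i < k) _ in cost.
pose D := \sum_(i < k) (d%:R / 2 - 1 : R) - e0.
pose eta := (e - e0) / (e - e0 + `|D| + 1).
have den0 : 0 < e - e0 + `|D| + 1.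
  by rewrite ltr_wpDl// addr_ge0// subr_ge0 ltW.
have eta0 : 0 < eta by rewrite divr_gt0// subr_gt0.
have eta1 : eta < 1.
  rewrite ltr_pdivrMr// mul1r -addrA ltrDl ltr_wpDl//.
have etaD : eta * D < e - e0.
  have : eta * D <= eta * `|D| by rewrite ler_wpM2l ?ler_norm// ltW.
  move=> /le_lt_trans; apply; rewrite /eta mulrAC ltr_pdivrMr// ltr_pM2l ?subr_gt0//.
  by rewrite -addrA addrCA ltrDl ltr_wpDl// subr_ge0 ltW.
clearbody eta.
apply: (@strong_bound _ d k a (fun i => (1 - eta) * w1 i + eta * (1 - a i / 2))
  (fun i => (1 - eta) * w2 i) (fun i => (1 - eta) * w3 i + eta * (a i / 2))
  (fun i => (1 - eta) * w4 i)) => //.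
- move=> i ik; have [w10 w20 w30 w40 ws] := wP _ ik.
  have /andP[a0 a1] := a01 _ ik.
  have e1 : 0 <= 1 - eta by rewrite subr_ge0 ltW.
  have a2 : 0 <= 1 - a i / 2 by lra.
  have a3 : 0 <= a i / 2 by lra.
  split; last by have /= := congr1 (fun t => (1 - eta) * t) ws; lra.
  - by apply: addr_ge0; apply: mulr_ge0 => //; exact: ltW.
  - exact: mulr_ge0.
  - by apply: addr_ge0; apply: mulr_ge0 => //; exact: ltW.
  - exact: mulr_ge0.
- by move=> i /a01/andP[].
- move=> i ik; have /andP[a0 a1] := a01 _ ik.
  have : (1 - eta) * (w2 i + w3 i + (1 - 2 / d%:R) * w4 i) <= (1 - eta) * a i.
    by rewrite ler_wpM2l ?al_le// subr_ge0 ltW.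
  have : 0 < eta * a i by rewrite mulr_gt0.
  lra.
- have -> : \sum_(i < k) ((1 - eta) * w3 i + eta * (a i / 2) + 2 / d%:R * ((1 - eta) * w4 i))
    = (1 - eta) * \sum_(i < k) (w3 i + 2 / d%:R * w4 i) + eta / 2 * \sum_(i < k) a i.
    by rewrite !mulr_sumr -big_split/=; apply: eq_bigr => i _; ring.
  have : (1 - eta) * 1 <= (1 - eta) * \sum_(i < k) (w3 i + 2 / d%:R * w4 i).
    by rewrite ler_wpM2l// subr_ge0 ltW.
  have : eta / 2 * 2 <= eta / 2 * \sum_(i < k) a i.
    by rewrite ler_wpM2l// divr_ge0// ltW.
  lra.
- have -> : \sum_(i < k) ((d%:R / 2 - 1) * ((1 - eta) * w1 i + eta * (1 - a i / 2)
      + ((1 - eta) * w3 i + eta * (a i / 2))) + (1 - eta) * w4 i) =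
      (1 - eta) * e0 + eta * \sum_(i < k) (d%:R / 2 - 1 : R).
    by rewrite /e0 !mulr_sumr -big_split/=; apply: eq_bigr => i _; ring.
  move: etaD; rewrite /D; lra.
Qed.

Local Open Scope ereal_scope.

(** * Norms on the lattice *)

Lemma lattice_integral_set1 (R : realType) d (f : lattice d -> \bar R) y :
  \int[(counting : {measure set (lattice d) -> \bar R})]_(x in [set y]%classic) f x = f y.
Proof.
rewrite (eq_integral (cst (f y))); last by move=> x; rewrite inE/= => ->.
rewrite integral_cst//= /counting asboolT ?finite_set1//.
by rewrite fset_set1 finmap.cardfs1 mule1.
Qed.

Lemma lattice_integral_seq (R : realType) d (f : lattice d -> \bar R)
   (Y : seq 'rV[int]_d) :
  (forall x, 0 <= f x) -> uniq Y ->
  \int[(counting : {measure set (lattice d) -> \bar R})]_(x in [set` Y]%classic) f x =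
  \sum_(y <- Y) f y.
Proof.
move=> f0 uY.
have -> : [set` Y]%classic = \big[setU/set0]_(y <- Y) [set (y : lattice d)]%classic.
  by rewrite -bigcup_seq; apply/seteqP; split => x /=; [exists x|move=> [y yY ->]].
rewrite (@ge0_integral_bigsetU _ _ _ _ 'rV[int]_d)//.
  by apply: eq_bigr => y _; exact: lattice_integral_set1.
by move=> x y _ _ [z [/= -> ->]].
Qed.

Lemma lattice_sum_le_integral (R : realType) d (f : lattice d -> \bar R)
   (Y : seq 'rV[int]_d) :
  (forall x, 0 <= f x) -> uniq Y ->
  \sum_(y <- Y) f y <= \int[(counting : {measure set (lattice d) -> \bar R})]_x f x.
Proof. by move=> f0 uY; rewrite -lattice_integral_seq//; exact: ge0_subset_integral. Qed.

Lemma lattice_integral_le (R : realType) d (f : lattice d -> \bar R) (B : \bar R) :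
  (forall x, 0 <= f x) ->
  (forall Y : seq 'rV[int]_d, uniq Y -> \sum_(y <- Y) f y <= B) ->
  \int[(counting : {measure set (lattice d) -> \bar R})]_x f x <= B.
Proof.
move=> f0 fB.
(* Partition of the lattice into singletons and empty sets along an enumeration. *)
pose F n : set (lattice d) := [set x | pickle (x : 'rV[int]_d) = n]%classic.
have FT : [set: lattice d]%classic = (\bigcup_n F n)%classic.
  by apply/seteqP; split => x // _; exists (pickle (x : 'rV[int]_d)).
rewrite FT ge0_integral_bigcup//; last first.
  by move=> n m _ _ [x [/= <- <-]].
apply: lime_le.
  by apply: is_cvg_nneseries => n _ _; apply: integral_ge0.
apply: nearW => m.
pose Y := pmap (@pickle_inv 'rV[int]_d) (iota 0 m).
have uY : uniq Y.
  apply: (@pmap_uniq _ _ _ (@pickle 'rV[int]_d)); last exact: iota_uniq.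
  exact: pickle_invK.
apply: le_trans (fB Y uY).
rewrite /Y big_pmap /index_iota subn0 le_eqVlt; apply/orP; left; apply/eqP.
apply: eq_bigr => n _.
case E : (pickle_inv n) => [y|].
  have -> : F n = [set (y : lattice d)]%classic.
    apply/seteqP; split => x /=.
      by move=> xn; have := pickleK_inv (x : 'rV[int]_d); rewrite xn E => -[->].
    by move=> ->; have := @pickle_invK 'rV[int]_d n; rewrite E.
  exact: lattice_integral_set1.
have -> : F n = set0.
  apply/seteqP; split => x //= xn.
  by have := pickleK_inv (x : 'rV[int]_d); rewrite xn E.
by rewrite integral_set0.
Qed.

Local Close Scope ereal_scope.

Local Notation normc := ComplexField.Normc.normc.

Lemma normc_ge0 (R : rcfType) (z : R[i]) : 0 <= normc z.
Proof. by case: z => x y; exact: sqrtr_ge0. Qed.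

Lemma normc_norm (R : rcfType) (z : R[i]) : (normc z)%:C%C = `|z|.
Proof. by []. Qed.

Lemma normc_sum_le (R : rcfType) (I : Type) (s : seq I) (F : I -> R[i]) :
  normc (\sum_(i <- s) F i) <= \sum_(i <- s) normc (F i).
Proof.
rewrite -lecR rmorph_sum/= normc_norm.
exact: ler_norm_sum.
Qed.

Lemma normc_prod (R : rcfType) (I : finType) (F : I -> R[i]) :
  normc (\prod_i F i) = \prod_i normc (F i).
Proof.
apply: (big_morph (@normc R)); first exact: ComplexField.Normc.normcM.
exact: ComplexField.Normc.normc1.
Qed.

(** Forgetting the mutual distances of the vertices embeds the simplices into
the k-tuples of points of the sphere. *)
Lemma sum_simplices_le (R : realType) d k lam (g : nat -> 'rV[int]_d -> R) x :
  (forall i y, 0 <= g i y) ->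
  \sum_(u <- finmap.enum_fset (fset_set (simplices d k lam))) \prod_(i < k) g i (x - row i u) <=
  \prod_(i < k) \sum_(v <- sphere d lam) g i (x - v).
Proof.
move=> g0; pose r := size (sphere d lam).
pose mat (phi : {ffun 'I_k -> 'I_r}) : 'M[int]_(k, d) :=
  \matrix_(i, c) (nth 0 (sphere d lam) (phi i)) 0 c.
have rowmat phi i : row i (mat phi) = nth 0 (sphere d lam) (phi i).
  by apply/rowP => c; rewrite !mxE.
have -> : \prod_(i < k) \sum_(v <- sphere d lam) g i (x - v) =
    \sum_(u <- [seq mat phi | phi <- enum predT]) \prod_(i < k) g i (x - row i u).
  under eq_bigr do rewrite (big_nth 0) big_mkord.
  rewrite bigA_distr_bigA big_map big_enum/=; apply: eq_bigr => phi _.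
  by apply: eq_bigr => i _; rewrite rowmat.
apply: ler_sum_uniq_sub.
- exact: finmap.fset_uniq.
- rewrite map_inj_uniq ?enum_uniq// => phi psi eqm; apply/ffunP => i.
  apply/val_inj/eqP; rewrite -(nth_uniq 0 _ _ (sphere_uniq d lam)) ?ltn_ord//.
  by rewrite -!rowmat eqm.
- move=> u; rewrite (in_fset_set (finite_simplices d k lam)) inE => -[uS _].
  have uS' i : row i u \in sphere d lam by rewrite mem_sphere; exact/eqP/uS.
  have lt i : (index (row i u) (sphere d lam) < r)%N by rewrite index_mem.
  apply/mapP; exists [ffun i => Ordinal (lt i)]; first by rewrite mem_enum.
  by apply/row_matrixP => i; rewrite rowmat ffunE/= nth_index.
- by move=> u; apply: prodr_ge0 => i _; exact: g0.
Qed.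

Lemma normc_Tsim_le (R : realType) d k lam (f : nat -> lattice d -> R[i]) x :
  normc (Tsim k lam f x) <=
  (lam%:R `^ (((d * k)%:R - (k * (k + 1))%:R) / 2))^-1 *
  \prod_(i < k) \sum_(v <- sphere d lam) normc (f i.+1 (x - v)).
Proof.
rewrite /Tsim fsbig_finite; last exact: finite_simplices.
rewrite -lecR normc_norm normrM [leRHS]rmorphM/=.
set s := lam%:R `^ _.
have s0 : 0 <= s^-1 by rewrite invr_ge0 powR_ge0.
have -> : `|(s^-1)%:C%C| = (s^-1)%:C%C by rewrite ger0_norm// lecR.
rewrite ler_wpM2l ?lecR//.
apply: le_trans (normc_sum_le _ _) _.
rewrite (eq_bigr _ (fun u _ => normc_prod _)).
by apply: (@sum_simplices_le R d k lam (fun i y => normc (f i.+1 y))) => i y; exact: normc_ge0.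
Qed.

Local Open Scope ereal_scope.

Lemma lpnorm_ge0 (R : realType) d (q : R) (f : lattice d -> R[i]) : 0 <= lpnorm q f.
Proof. exact: Lnorm_ge0. Qed.

Lemma sum_powR_le_lpnorm (R : realType) d (q : R) (f : lattice d -> R[i])
    (Y : seq 'rV[int]_d) : (0 < q)%R -> lpnorm q f != +oo -> uniq Y ->
  (\sum_(y <- Y) normc (f y) `^ q <= fine (lpnorm q f) `^ q)%R.
Proof.
move=> q0 fin uY; rewrite -lee_fin -poweR_EFin.
have -> : (fine (lpnorm q f))%:E = lpnorm q f.
  by rewrite fineK// ge0_fin_numE ?lpnorm_ge0// ltey.
rewrite /lpnorm poweR_Lnorm ?gt_eqF//.
apply: le_trans (lattice_sum_le_integral _ uY).
  rewrite -sumEFin le_eqVlt; apply/orP; left; apply/eqP; apply: eq_bigr => y _.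
  by rewrite /= ger0_norm ?normc_ge0.
by move=> x; exact: poweR_ge0.
Qed.

Lemma lpnorm1_le (R : realType) d (f : lattice d -> R[i]) (B : \bar R) :
  (forall Y : seq 'rV[int]_d, uniq Y -> (\sum_(y <- Y) normc (f y))%:E <= B) ->
  lpnorm 1 f <= B.
Proof.
move=> fB; rewrite /lpnorm Lnorm1; apply: lattice_integral_le => // Y uY.
apply: le_trans (fB _ uY).
rewrite -sumEFin le_eqVlt; apply/orP; left; apply/eqP; apply: eq_bigr => y _.
by rewrite /= ger0_norm ?normc_ge0.
Qed.

Lemma prode_pinfty (R : realType) (I : finType) (F : I -> \bar R) i0 :
  (forall i, 0 < F i) -> F i0 = +oo -> \prod_i F i = +oo.
Proof.
move=> F0 Fi0; rewrite (bigD1 i0)//= Fi0 gt0_mulye//.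
by apply: (big_ind (fun x => 0 < x)) => // x y x0 y0; exact: mule_gt0.
Qed.

(** When all the norms are finite this is the multilinear bound on finite sets of
points x. Otherwise the right-hand side is infinite unless one of the norms
vanishes, and then so does its function. *)
Lemma Tsim_bound (R : realType) (d k : nat) (q w1 w2 w3 w4 : nat -> R) (e : R) :
  (4 <= d)%N ->
  (forall i, (i < k)%N -> [/\ 0 <= w1 i, 0 <= w2 i, 0 <= w3 i, 0 <= w4 i &
     w1 i + w2 i + w3 i + w4 i = 1])%R ->
  (forall i, (i < k)%N -> 1 <= q i)%R ->
  (forall i, (i < k)%N -> w2 i + w3 i + (1 - 2 / d%:R) * w4 i <= (q i)^-1)%R ->
  (2 <= \sum_(i < k) (q i)^-1)%R ->
  (1 <= \sum_(i < k) (w3 i + 2 / d%:R * w4 i))%R ->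
  (\sum_(i < k) ((d%:R / 2 - 1) * (w1 i + w3 i) + w4 i) <
   e + ((d * k)%:R - (k * (k + 1))%:R) / 2)%R ->
  exists2 C : R, (0 < C)%R &
  forall (lam : nat) (f : nat -> lattice d -> R[i]), (0 < lam)%N ->
  lpnorm 1 (Tsim k lam f) <=
  (C * lam%:R `^ e)%:E * \prod_(i < k) lpnorm (q i) (f i.+1).
Proof.
move=> d4 wP q1 al_le sum_a sum_b cost.
have q0 i : (i < k)%N -> (0 < q i)%R.
  by move=> ik; apply: lt_le_trans (q1 _ ik).
have a01 i : (i < k)%N -> (0 < (q i)^-1 <= 1)%R.
  by move=> ik; rewrite invr_gt0 q0//= invf_le1 ?q0// q1.
have [C C0 CP] := multilinear_sphere_bound d4 wP a01 al_le sum_a sum_b cost.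
exists C => // lam f lam0.
have lamp : (0 < lam%:R :> R)%R by rewrite ltr0n.
set rhs := _ * _.
have rhs0 : 0 <= rhs.
  rewrite mule_ge0 ?lee_fin ?mulr_ge0 ?powR_ge0 ?(ltW C0)//.
  by apply: prode_ge0 => i _; exact: lpnorm_ge0.
have [/existsP[/= i0 /eqP fi0]|/existsPn fin] :=
  boolP [exists i : 'I_k, lpnorm (q i) (f i.+1) == +oo]; last first.
  pose A i := fine (lpnorm (q i) (f i.+1)).
  have -> : rhs = (C * lam%:R `^ e * \prod_(i < k) A i)%:E.
    rewrite /rhs [RHS]EFinM; congr (_ * _).
    rewrite (big_morph EFin (@EFinM R) (erefl 1)); apply: eq_bigr => i _.
    by rewrite /A fineK// ge0_fin_numE ?lpnorm_ge0// ltey fin.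
  apply: lpnorm1_le => Y uY; rewrite lee_fin.
  set S := (((d * k)%:R - (k * (k + 1))%:R) / 2)%R in CP.
  have := CP lam Y (fun i y => normc (f i.+1 y)) A lam0 uY.
  move=> /(_ (fun i => fine_ge0 (lpnorm_ge0 _ _)) (fun i y => normc_ge0 _)).
  move=> H; have {}H := H _.
  apply: (@le_trans _ _ (\sum_(x <- Y) (lam%:R `^ S)^-1 *
      \prod_(i < k) \sum_(v <- sphere d lam) normc (f i.+1 (x - v)))%R).
    by apply: ler_sum => x _; exact: normc_Tsim_le.
  rewrite -mulr_sumr -ler_pdivlMl ?invr_gt0 ?powR_gt0// invrK.
  apply: le_trans (H _) _.
    move=> i Z ik uZ; rewrite invrK; apply: sum_powR_le_lpnorm => //.
      exact: q0.
    exact: (fin (Ordinal ik)).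
  rewrite powRD ?(gt_eqF lamp) ?implybT// le_eqVlt; apply/orP; left; apply/eqP.
  by ring.
have [/existsP[/= i1 /eqP fi1]|/existsPn nz] :=
  boolP [exists i : 'I_k, lpnorm (q i) (f i.+1) == 0]; last first.
  suff -> : rhs = +oo by rewrite leey.
  rewrite /rhs (@prode_pinfty _ _ _ i0)//.
    by rewrite gt0_muley// lte_fin mulr_gt0// powR_gt0.
  by move=> i; rewrite lt0e nz lpnorm_ge0.
have f0 y : normc (f i1.+1 y) = 0%R.
  have := @sum_powR_le_lpnorm _ _ (q i1) (f i1.+1) [:: y] (q0 _ (ltn_ord i1)).
  rewrite fi1 /= big_seq1 => /(_ isT isT).
  rewrite powR0 ?gt_eqF ?q0// => le0.
  have : (normc (f i1.+1 y) `^ q i1 == 0)%R by rewrite eq_le le0 powR_ge0.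
  by rewrite powR_eq0 => /andP[/eqP].
apply: lpnorm1_le => Y uY; apply: le_trans rhs0; rewrite lee_fin.
apply: sumr_le0 => x _; apply: le_trans (normc_Tsim_le _ _ _ _) _.
by rewrite (bigD1 i1)//= big1 ?mul0r ?mulr0// => v _; exact: f0.
Qed.

Local Close Scope ereal_scope.

(** * Admissible exponents *)

(** The point (a, b) is a barycentre of (0, 0), (1, 0), (1, 1) and the vertex
(1 - 2/d, 2/d) of the incidence bound, with c the weight of (1, 0). In terms
of exponents, f in l^(1/a) is sent into (weak) l^(1/b) by summation over the
sphere. The corner (1, 0) is the only one whose gain is not
lam^(d/2 (a - b)): it loses a factor lam. *)
Definition in_region (R : realType) (d a b c : R) : Prop :=
  exists w : R * R * R * R, let: (w1, w2, w3, w4) := w in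
  [/\ [/\ 0 <= w1, 0 <= w2, 0 <= w3 & 0 <= w4], w1 + w2 + w3 + w4 = 1,
      w2 + w3 + (1 - 2 / d) * w4 = a, w3 + 2 / d * w4 = b & w2 = c].

(** Solving for w1 turns the cost of the weights into the scaling gain
d/2 (a - b), up to the loss c. *)
Lemma Tsim_bound_region (R : realType) (d k : nat) (q b c : nat -> R) (e : R) :
  (4 <= d)%N ->
  (forall i, (i < k)%N -> 1 <= q i) ->
  (forall i, (i < k)%N -> in_region d%:R (q i)^-1 (b i) (c i)) ->
  2 <= \sum_(i < k) (q i)^-1 ->
  1 <= \sum_(i < k) b i ->
  \sum_(i < k) (d%:R / 2 - 1 - d%:R / 2 * ((q i)^-1 - b i) + c i) <
   e + ((d * k)%:R - (k * (k + 1))%:R) / 2 ->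
  exists2 C : R, 0 < C &
  forall (lam : nat) (f : nat -> lattice d -> R[i]), (0 < lam)%N ->
  (lpnorm 1 (Tsim k lam f) <=
  (C * lam%:R `^ e)%:E * \prod_(i < k) lpnorm (q i) (f i.+1))%E.
Proof.
move=> d4 q1 reg sum_a sum_b cost.
have /choice[w wP] : forall i, exists w : R * R * R * R, (i < k)%N ->
  let: (w1, w2, w3, w4) := w in
  [/\ [/\ 0 <= w1, 0 <= w2, 0 <= w3 & 0 <= w4], w1 + w2 + w3 + w4 = 1,
      w2 + w3 + (1 - 2 / d%:R) * w4 = (q i)^-1, w3 + 2 / d%:R * w4 = b i & w2 = c i].
  by move=> i; have [/reg[w wP]|_] := ltnP i k; [exists w|exists (0, 0, 0, 0)].
have d0 : (d%:R : R) != 0 by rewrite pnatr_eq0; case: (d) d4.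
apply: (@Tsim_bound R d k q (fun i => (w i).1.1.1) (fun i => (w i).1.1.2)
   (fun i => (w i).1.2) (fun i => (w i).2)) => //.
- by move=> i /wP; case: (w i) => [[[w1 w2] w3] w4] /= [[]].
- by move=> i /wP; case: (w i) => [[[w1 w2] w3] w4] /= [_ _ -> _ _].
- rewrite (eq_bigr (fun i : 'I_k => b i))// => i _.
  by have := wP _ (ltn_ord i); case: (w i) => [[[w1 w2] w3] w4] /= [].
- apply: le_lt_trans cost; rewrite le_eqVlt; apply/orP; left; apply/eqP.
  apply: eq_bigr => i _.
  have := wP _ (ltn_ord i); case: (w i) => [[[w1 w2] w3] w4] /= [_ sw <- <- <-].
  have -> : w1 = 1 - w2 - w3 - w4 by rewrite -sw; ring.
  by field.
Qed.

Lemma in_region_diag (R : realType) (d x : R) : 0 <= x <= 1 ->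
  in_region d x x 0.
Proof.
move=> /andP[x0 x1]; exists (1 - x, 0, x, 0).
by split; [split|..]; rewrite ?subr_ge0//; ring.
Qed.

Lemma in_region_trivial (R : realType) (d y : R) : 0 <= y <= 1 / 2 ->
  in_region d (1 - y) y (1 - 2 * y).
Proof.
move=> y01; exists (y, 1 - 2 * y, y, 0).
by split; [split|..] => //; try ring; lra.
Qed.

(** On the segment that joins the vertex (1 - 2/d, 2/d) to (1/2, 1/2). *)
Lemma in_region_antidiag (R : realType) (d y : R) : 4 < d -> 2 / d <= y <= 1 / 2 ->
  in_region d (1 - y) y 0.
Proof.
move=> d4 /andP[yd y2].
have d0 : 0 < d by lra.
have d4' : 0 < d - 4 by lra.
pose g := d * (1 - 2 * y) / (d - 4).
have yd' : 2 <= d * y by rewrite mulrC -ler_pdivrMr.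
have g0 : 0 <= g by rewrite divr_ge0 ?mulr_ge0//; lra.
have g1 : g <= 1 by rewrite ler_pdivrMr// mul1r; nra.
exists ((1 - g) / 2, 0, (1 - g) / 2, g).
split; [split; lra|lra| | |by []].
  by rewrite /g; field; rewrite !gt_eqF.
by rewrite /g; field; rewrite !gt_eqF.
Qed.

(** The points with 1 - a = y < 2/d in the triangle with corners (1, 0), (1, 1) and
(1 - 2/d, 2/d): the weight 1 - d y / 2 that the vertex leaves is shared between
the two corners. *)
Lemma in_region_edge (R : realType) (d y u : R) : 4 < d -> 0 <= y ->
  0 <= u <= 1 - d * y / 2 ->
  in_region d (1 - y) (y + u) (1 - d * y / 2 - u).
Proof.
move=> d4 y0 /andP[u0 u1]; have d0 : 0 < d by lra.
exists (0, 1 - d * y / 2 - u, u, d * y / 2).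
split; [split; try lra|lra| | |by []].
- by rewrite divr_ge0// mulr_ge0// ltW.
- by field; rewrite gt_eqF.
- by field; rewrite gt_eqF.
Qed.

(** For y slightly below 2/d the point (1 - y, y) is outside the region of
full gain, but it is enough to raise b by less than y / 2. *)
Lemma in_region_mid (R : realType) (d y : R) : 4 < d -> 2 / (d + 1) < y <= 1 / 2 ->
  exists2 u, 0 <= u <= y / 2 & in_region d (1 - y) (y + u) 0.
Proof.
move=> d4 /andP[yd y2]; have d0 : 0 < d by lra.
have y0 : 0 < y by apply: lt_trans yd; rewrite divr_gt0//; lra.
have yd' : 2 < y * (d + 1) by rewrite -ltr_pdivrMr//; lra.
have [vy|yv] := leP (2 / d) y.
  exists 0; first by lra.
  by rewrite addr0; apply: in_region_antidiag => //; rewrite vy.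
have yv' : y * d < 2 by rewrite -ltr_pdivlMr.
exists (1 - d * y / 2); first by apply/andP; split; lra.
rewrite -[X in in_region _ _ _ X](subrr (1 - d * y / 2)).
have dy : d * y = y * d by rewrite mulrC.
apply: in_region_edge => //; first lra.
by rewrite lexx andbT; lra.
Qed.

(** For the last exponent, which may be large, the part of the deficit
1 - d y / 2 that exceeds 1 / (d + 1) is paid with powers of lam. *)
Lemma in_region_last (R : realType) (d y : R) : 4 < d -> 0 <= y <= 1 / 2 ->
  exists u c, [/\ 0 <= u <= (d + 1)^-1, c <= 0 \/ c <= d / (d + 1) - d * y / 2
                & in_region d (1 - y) (y + u) c].
Proof.
move=> d4 /andP[y0 y2]; have d0 : 0 < d by lra.
have d1 : 0 < (d + 1)^-1 by rewrite invr_gt0; lra.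
have [vy|yv] := leP (2 / d) y.
  exists 0, 0; split; [by rewrite lexx ltW|by left|].
  by rewrite addr0; apply: in_region_antidiag => //; rewrite vy.
have yv' : y * d < 2 by rewrite -ltr_pdivlMr.
have [le|ge] := leP (1 - d * y / 2) (d + 1)^-1.
  exists (1 - d * y / 2), 0; split; [by rewrite le andbT; nra|by left|].
  rewrite -[X in in_region _ _ _ X](subrr (1 - d * y / 2)).
  have dy : d * y = y * d by rewrite mulrC.
by apply: in_region_edge => //; rewrite lexx andbT; lra.
exists (d + 1)^-1, (1 - d * y / 2 - (d + 1)^-1); split.
- by rewrite lexx ltW.
- right; have -> : d / (d + 1) = 1 - (d + 1)^-1 by field; rewrite gt_eqF//; lra.
  lra.
- by apply: in_region_edge => //; rewrite (ltW d1) ltW.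
Qed.

(** The room that the first function leaves below the diagonal: its b may be
lowered by T to compensate for the increases of the other ones. *)
Lemma in_region_first (R : realType) (d x T : R) : 4 < d -> 0 <= T ->
  T * (d - 2) <= x * (d - 4) -> 2 * T <= (1 - x) * (d - 4) ->
  in_region d x (x - T) 0.
Proof.
move=> d4 T0 T1 T2; have d0 : 0 < d by lra.
have d4' : 0 < d - 4 by lra.
pose g := T * d / (d - 4).
have gE : g * (d - 4) = T * d by rewrite /g divfK// gt_eqF.
have g0 : 0 <= g by rewrite divr_ge0 ?mulr_ge0// ltW.
have g2 : 2 / d * g = 2 * T / (d - 4) by rewrite /g; field; rewrite !gt_eqF.
have T1' : T + 2 * T / (d - 4) <= x.
  by rewrite -lerBrDl ler_pdivrMr//; lra.
have T2' : 2 * T / (d - 4) <= 1 - x by rewrite ler_pdivrMr.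
have gg : g = T + 4 * T / (d - 4) by rewrite /g; field; rewrite gt_eqF.
exists (1 - x - 2 * T / (d - 4), 0, x - T - 2 * T / (d - 4), g).
split; [split => //; lra|rewrite gg; lra| | |by []].
  by rewrite mulrBl g2 gg; lra.
by rewrite g2; lra.
Qed.

(** * The two ranges of exponents *)

Lemma inv_conj_exp (R : realType) (r : R) : 1 < r -> (conj_exp r)^-1 = 1 - r^-1.
Proof.
move=> r1; rewrite /conj_exp invf_div mulrBl mul1r divff// gt_eqF//.
exact: lt_trans r1.
Qed.

Lemma conj_exp_ge1 (R : realType) (r : R) : 1 < r -> 1 <= conj_exp r.
Proof. by move=> r1; rewrite /conj_exp ler_pdivlMr ?subr_gt0// mul1r gerBl. Qed.

(** The exponents of the norms of the functions, indexed from 0. *)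
Definition input_exp (R : realType) (p : nat -> R) (i : nat) : R :=
  if i is 0%N then p 1%N else conj_exp (p i.+1).

Lemma prod_input_exp (R : realType) (p : nat -> R) n (F : R -> nat -> \bar R) :
  (F (p 1%N) 1%N * \prod_(2 <= i < n.+2) F (conj_exp (p i)) i =
   \prod_(i < n.+1) F (input_exp p i) i.+1)%E.
Proof. by rewrite big_ord_recl/= big_add1 big_add1 big_mkord. Qed.

Lemma sum_ends (R : realType) (F : nat -> R) m :
  \sum_(i < m.+2) F i = F 0%N + (\sum_(i < m) F i.+1 + F m.+1).
Proof. by rewrite big_ord_recl/= big_ord_recr. Qed.

(** Only the corners (0, 0), (1, 0) and (1, 1) are used, at the points (x, x)
and (1 - y_i, y_i), where x = 1 / p_1 and y_i = 1 / p_i; Hoelder's condition is the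
hypothesis on the sum of the 1 / p_i. The bounds on the exponents, in terms of
t = 2 / (d + 1), leave the strict inequality that is needed: for j = k - 1
every intermediate y_i exceeds t, and for smaller j at least two of the y_i are
at most t. *)
Lemma Tsim_bound_corners (R : realType) (d m j : nat) (p : nat -> R) :
  (2 * m.+2 + 3 <= d)%N -> (0 < m)%N -> (j <= m)%N ->
  (d%:R + 1) / (d%:R - 1) < p 1%N < 2 ->
  (forall i, (i <= m)%N -> 2 < p i.+2) ->
  (forall i, (i < j)%N -> p i.+2 < (d%:R + 1) / 2) ->
  (forall i, (j <= i <= m)%N -> (j < m)%N -> (d%:R + 1) / 2 <= p i.+2) ->
  \sum_(i < m.+2) (p i.+1)^-1 = 1 ->
  exists2 C : R, 0 < C &
     forall (lam : nat) (f : nat -> lattice d -> R[i]), (0 < lam)%N ->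
     (lpnorm 1 (Tsim m.+2 lam f) <=
      (C * lam%:R `^ ((m.+2%:R * (m.+2%:R - 1) - d%:R * j.+1%:R) / 2
                      + d%:R / conj_exp (p 1%N)
                      + \sum_(i < j) d%:R / p i.+2))%:E
      * \prod_(i < m.+2) lpnorm (input_exp p i) (f i.+1))%E.
Proof.
move=> hd m0 jm /andP[p1l p1u] p2 psmall plarge psum.
pose D : R := d%:R; pose M : R := m%:R; pose t : R := 2 / (D + 1).
have D9 : 2 * M + 7 <= D by rewrite /D /M -natrM -natrD ler_nat; lia.
have M1 : 1 <= M by rewrite (ler_nat _ 1).
have tD : t * (D + 1) = 2 by rewrite /t divfK// gt_eqF//; lra.
have t0 : 0 < t by rewrite divr_gt0//; lra.
have t1 : t <= 1 / 5 by rewrite ler_pdivrMr; lra.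
have p1gt1 : 1 < p 1%N.
  by apply: lt_trans p1l; rewrite ltr_pdivlMr; lra.
set x := (p 1%N)^-1 in psum.
have x2 : 1 / 2 < x by rewrite div1r ltf_pV2// posrE; lra.
have xt : x < 1 - t.
  have -> : 1 - t = ((D + 1) / (D - 1))^-1 by rewrite /t; field; apply/andP; split; rewrite gt_eqF//; lra.
  by rewrite ltf_pV2 ?posrE ?divr_gt0//; lra.
pose y i := (p i.+2)^-1.
have y0 i : (i <= m)%N -> 0 <= y i <= 1 / 2.
  move=> im; have := p2 _ im => pi.
  by rewrite invr_ge0 div1r ler_pV2 ?inE ?unitfE ?gt_eqF//; lra.
have ysum : x + (\sum_(i < m) y i + y m) = 1 by rewrite -psum (sum_ends (fun i => (p i.+1)^-1)).
have qV i : (i < m.+2)%N -> (input_exp p i)^-1 = if i is i'.+1 then 1 - y i' else x.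
  case: i => [//|i] im; rewrite /= inv_conj_exp//.
  by apply: lt_trans (p2 _ _) => //; lra.
pose Z := \sum_(i < j) y i.
have D1h : 0 < (D + 1) / 2 by lra.
have pp i : (i <= m)%N -> 0 < p i.+2 by move=> /p2; lra.
rewrite (_ : \sum_(i < j) d%:R / p i.+2 = D * Z); last by rewrite mulr_sumr.
have -> : d%:R / conj_exp (p 1%N) = D * (1 - x) by rewrite inv_conj_exp.
apply: (@Tsim_bound_region R d m.+2 (input_exp p)
  (fun i => if i is i'.+1 then y i' else x)
  (fun i => if i is i'.+1 then 1 - 2 * y i' else 0)).
- by move: hd; clear; lia.
- case=> [|i] im /=; first exact: ltW.
  by apply: conj_exp_ge1; apply: lt_trans (p2 _ _) => //; lra.
- move=> i im; rewrite qV//; case: i im => [|i] im.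
    by apply: in_region_diag; lra.
  exact: in_region_trivial (y0 _ im).
- rewrite (eq_bigr (fun i : 'I_m.+2 => if val i is i'.+1 then 1 - y i' else x)); last first.
    by move=> i _; rewrite qV.
  rewrite (sum_ends (fun i => if i is i'.+1 then 1 - y i' else x)) sumrB.
  by rewrite sumr_const card_ord -/M; lra.
- by rewrite (sum_ends (fun i => if i is i'.+1 then y i' else x)) ysum.
rewrite (eq_bigr (fun i : 'I_m.+2 => if val i is i'.+1 then (D - 2) * y i' else D / 2 - 1)); last first.
  by move=> i _; rewrite qV//; case: i => -[|i] im /=; rewrite -/D; lra.
rewrite (sum_ends (fun i => if i is i'.+1 then (D - 2) * y i' else D / 2 - 1)).
rewrite -mulr_sumr -mulrDr (_ : \sum_(i < m) y i + y m = 1 - x); last by lra.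
rewrite !natrM natrD -/D.
have -> : m.+2%:R = M + 2 by rewrite -natrD addn2.
have -> : j.+1%:R = j%:R + 1 :> R by rewrite natr1.
have xD : x * (D + 1) < D - 1 by nra.
move: jm; rewrite leq_eqVlt => /orP[/eqP jm|jm].
  have Zt : M * t <= Z.
    rewrite /Z jm /M mulr_natl -[X in _ *+ X](card_ord m) -sumr_const.
    apply: ler_sum => i _; rewrite /t -invf_div lef_pV2 ?posrE ?pp//.
      by apply/ltW/psmall; rewrite jm.
    by rewrite ltnW.
  rewrite jm -/M; nra.
pose n : R := (m - j).+1%:R.
have nE : n = M - j%:R + 1 by rewrite /n -natr1 natrB// ltnW.
have n2 : 2 <= n by rewrite /n ler_nat ltnS subn_gt0.
have Zt : 1 - x - Z <= n * t.
  have -> : 1 - x - Z = \sum_(j <= i < m.+1) y i.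
    rewrite -ysum -(big_mkord xpredT y) /Z -(big_mkord xpredT y).
    rewrite (@big_cat_nat _ _ _ j 0 m)//=; last exact: ltnW.
    rewrite [RHS]big_nat_recr/=; last exact: ltnW.
    ring.
  rewrite /n -subSn ?(ltnW jm)// mulr_natl -sumr_const_nat.
  apply: ler_sum_nat => i ijm; rewrite /t -invf_div lef_pV2 ?posrE//.
    exact: plarge.
  by apply: pp; case/andP: ijm.
have e1 : D * (1 - x - Z) <= D * (n * t) by rewrite ler_wpM2l//; lra.
have e2 : 0 <= (n - 2) * (D / 2 - 2) by rewrite mulr_ge0//; lra.
have e3 : D * (n * t) = n * (2 - t) by rewrite -tD; ring.
have e4 : 0 <= n * t by rewrite mulr_ge0//; lra.
have e5 : 0 <= (D + 2) * (1 - x - t) by rewrite mulr_ge0//; lra.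
move: nE tD => nE tD; nra.
Qed.

(** As p_1 tends to 2 no power of lam can be lost, so the vertex of the incidence
bound is needed. Take b_i = y_i, increased by u_i where y_i is below 2/d,
and lower b_1 = x by the total increase T. The intermediate u_i are at
most y_i / 2, so that T <= (1 - x) / 2 + 1 / (d + 1), which the first function
affords since 1/2 < x < 3/4. The weight of (1, 0) for the last function is less than
d (x - 1/2) by the lower bound on 2 / p_1 + 1 / p_k. *)
Lemma Tsim_bound_improving (R : realType) (d m : nat) (p : nat -> R) :
  (2 * m.+2 + 3 <= d)%N -> (0 < m)%N -> 1 < p 1%N < 2 ->
  (forall i, (i <= m)%N -> 2 < p i.+2) ->
  (forall i, (i < m)%N -> p i.+2 < (d%:R + 1) / 2) ->
  \sum_(i < m.+2) (p i.+1)^-1 = 1 ->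
  (d%:R + 3) / (d%:R + 1) < 2 * (p 1%N)^-1 + (p m.+2)^-1 < 3 / 2 ->
  exists2 C : R, 0 < C &
     forall (lam : nat) (f : nat -> lattice d -> R[i]), (0 < lam)%N ->
     (lpnorm 1 (Tsim m.+2 lam f) <=
      (C * lam%:R `^ ((m.+2%:R * (m.+2%:R - 1) - d%:R * (m.+2%:R - 2)) / 2))%:E
      * \prod_(i < m.+2) lpnorm (input_exp p i) (f i.+1))%E.
Proof.
move=> hd m0 /andP[p1gt1 p1u] p2 psmall psum.
pose D : R := d%:R; pose M : R := m%:R; pose s : R := (D + 1)^-1.
have D9 : 9 <= D by rewrite (ler_nat _ 9); lia.
have M1 : 1 <= M by rewrite (ler_nat _ 1).
have D1 : 0 < D + 1 by lra.
have sD : s * (D + 1) = 1 by rewrite mulVf// gt_eqF.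
have s0 : 0 < s by rewrite invr_gt0.
have s1 : s <= 1 / 10 by rewrite div1r lef_pV2 ?posrE//; lra.
have sDs : 10 <= D + 12 * s.
  have e : (D + 12 * s) * (D + 1) = D * (D + 1) + 12 * (s * (D + 1)) by ring.
  by rewrite -(ler_pM2r D1) e sD; nra.
set x := (p 1%N)^-1 in psum *.
have x2 : 1 / 2 < x by rewrite div1r ltf_pV2// posrE; lra.
pose y i := (p i.+2)^-1.
rewrite -[(p m.+2)^-1]/(y m) -/D => /andP[h1 h2].
have {}h1 : 1 + 2 * s < 2 * x + y m.
  have -> : 1 + 2 * s = (D + 3) / (D + 1) by rewrite /s; field; rewrite gt_eqF.
  exact: h1.
have y0 i : (i <= m)%N -> 0 <= y i <= 1 / 2.
  move=> im; have := p2 _ im => pi.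
  by rewrite invr_ge0 div1r ler_pV2 ?inE ?unitfE ?gt_eqF//; lra.
have ysum : x + (\sum_(i < m) y i + y m) = 1 by rewrite -psum (sum_ends (fun i => (p i.+1)^-1)).
have qV i : (i < m.+2)%N -> (input_exp p i)^-1 = if i is i'.+1 then 1 - y i' else x.
  case: i => [//|i] im; rewrite /= inv_conj_exp//.
  by apply: lt_trans (p2 _ _) => //; lra.
have D4 : 4 < D by lra.
have /choice[u uP] : forall i, exists u, (i < m)%N ->
    0 <= u <= y i / 2 /\ in_region D (1 - y i) (y i + u) 0.
  move=> i; have [im|_] := ltnP i m; last by exists 0.
  have [|u u0 reg] := @in_region_mid R D (y i) D4; last by exists u.
  have := y0 i (ltnW im) => /andP[_ ->]; rewrite andbT -invf_div /y ltf_pV2 ?posrE.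
  - exact: psmall.
  - by rewrite divr_gt0.
  - by have := p2 i (ltnW im); lra.
have [ul [cl [/andP[ul0 ul1] cl1 reg_l]]] := in_region_last D4 (y0 m (leqnn m)).
rewrite -/s in ul1.
pose T := \sum_(i < m) u i + ul.
have T0 : 0 <= T.
  by rewrite addr_ge0// sumr_ge0// => i _; have [/andP[]] := uP _ (ltn_ord i).
have T1 : T <= (1 - x) / 2 + s.
  have : \sum_(i < m) u i <= \sum_(i < m) y i / 2.
    by apply: ler_sum => i _; have [/andP[]] := uP _ (ltn_ord i).
  rewrite -mulr_suml => Tu; have /andP[ym0 _] := y0 m (leqnn m).
  rewrite /T; lra.
have x34 : x < 3 / 4 by have /andP[ym0 _] := y0 m (leqnn m); lra.
have reg_f : in_region D x (x - T) 0.
  apply: in_region_first => //.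
    have : T * (D - 2) <= ((1 - x) / 2 + s) * (D - 2) by rewrite ler_wpM2r//; lra.
    have : 0 <= (x - 1 / 2) * (D - 4 + (D - 2) / 2) by rewrite mulr_ge0//; lra.
    lra.
  have : 0 <= (3 / 4 - x) * (D - 5) by rewrite mulr_ge0//; lra.
  lra.
apply: (@Tsim_bound_region R d m.+2 (input_exp p)
  (fun i => if i is i'.+1 then y i' + (if i' == m then ul else u i') else x - T)
  (fun i => if i == m.+1 then cl else 0)).
- by move: hd; clear; lia.
- case=> [|i] im /=; first exact: ltW.
  by apply: conj_exp_ge1; apply: lt_trans (p2 _ _) => //; lra.
- move=> i im; rewrite qV//; case: i im => [//|i] im; rewrite eqSS.
  case: eqP => [->//|/eqP ni].
  by apply: (uP i _).2; rewrite ltn_neqAle ni.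
- rewrite (eq_bigr (fun i : 'I_m.+2 => if val i is i'.+1 then 1 - y i' else x)); last first.
    by move=> i _; rewrite qV.
  rewrite (sum_ends (fun i => if i is i'.+1 then 1 - y i' else x)) sumrB.
  by rewrite sumr_const card_ord -/M; lra.
- rewrite (sum_ends (fun i => if i is i'.+1 then y i' + (if i' == m then ul else u i') else x - T)).
  rewrite eqxx (eq_bigr (fun i : 'I_m => y i + u i)); last first.
    by move=> i _; rewrite ltn_eqF.
  by rewrite big_split/=; move: ysum; rewrite /T; lra.
rewrite (eq_bigr (fun i : 'I_m.+2 => if val i is i'.+1 then
   D / 2 - 1 - D / 2 * (1 - 2 * y i' - (if i' == m then ul else u i')) +
   (if i' == m then cl else 0) else D / 2 - 1 - D / 2 * T)); last first.
  by move=> i _; rewrite qV//; case: i => -[|i] im /=; rewrite -/D ?eqSS; lra.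
rewrite (sum_ends (fun i => if i is i'.+1 then
   D / 2 - 1 - D / 2 * (1 - 2 * y i' - (if i' == m then ul else u i')) +
   (if i' == m then cl else 0) else D / 2 - 1 - D / 2 * T)) eqxx.
rewrite (eq_bigr (fun i : 'I_m => -1 + D * y i + D / 2 * u i)); last first.
  by move=> i _; rewrite ltn_eqF//; lra.
rewrite !big_split/= -!mulr_sumr sumr_const card_ord.
have -> : -1 *+ m = - M by rewrite mulNrn.
rewrite !natrM natrD -/D.
have -> : m.+2%:R = M + 2 by rewrite -natrD addn2.
have -> : \sum_(i < m) y i = 1 - x - y m by move: ysum; lra.
have -> : \sum_(i < m) u i = T - ul by rewrite /T addrK.
have e1 : D * (1 + 2 * s) < D * (2 * x + y m) by rewrite ltr_pM2l//; lra.
have e2 : 0 < D * (x - 1 / 2) by rewrite mulr_gt0//; lra.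
case: cl1 => cl1; first by lra.
by move: cl1; rewrite -/s => cl1; lra.
Qed.

Local Open Scope classical_set_scope.

Theorem proposition6 (R : realType) (d k j : nat) (p : nat -> R)
    (hk : (3 <= k)%N) (hd : (2 * k + 3 <= d)%N)
    (hp1 : (d%:R + 1) / (d%:R - 1) < p 1%N < 2) (hp2 : 2 < p 2%N)
    (hpmono : forall i : nat, (2 <= i < k)%N -> p i <= p i.+1)
    (hpsum : \sum_(1 <= i < k.+1) (p i)^-1 = 1)
    (hj : (1 <= j <= k - 1)%N) (hpj : p j < (d%:R + 1) / 2)
    (hjmax : forall i : nat,
       (1 <= i <= k - 1)%N -> p i < (d%:R + 1) / 2 -> (i <= j)%N) :
  (exists2 C : R, 0 < C &
     forall (lam : nat) (f : nat -> lattice d -> R[i]), (0 < lam)%N ->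
     (lpnorm 1 (Tsim k lam f) <=
      (C * lam%:R `^ ((k%:R * (k%:R - 1) - d%:R * j%:R) / 2
                      + d%:R / conj_exp (p 1%N)
                      + \sum_(2 <= i < j.+1) d%:R / p i))%:E
      * (lpnorm (p 1%N) (f 1%N)
         * \prod_(2 <= i < k.+1) lpnorm (conj_exp (p i)) (f i)))%E)
  /\
  (j = (k - 1)%N ->
   (d%:R + 3) / (d%:R + 1) < 2 * (p 1%N)^-1 + (p k)^-1 < 3 / 2 ->
   exists2 C : R, 0 < C &
     forall (lam : nat) (f : nat -> lattice d -> R[i]), (0 < lam)%N ->
     (lpnorm 1 (Tsim k lam f) <=
      (C * lam%:R `^ ((k%:R * (k%:R - 1) - d%:R * (k%:R - 2)) / 2))%:E
      * (lpnorm (p 1%N) (f 1%N)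
         * \prod_(2 <= i < k.+1) lpnorm (conj_exp (p i)) (f i)))%E).
Proof.
case: k hk hd hpmono hpsum hj hjmax => [//|[//|m]] hk hd hpmono hpsum hj hjmax.
have m0 : (0 < m)%N by [].
case: j hj hpj hjmax => [//|j] hj hpj hjmax.
have jm : (j <= m)%N by lia.
have mono a b : (a <= b <= m)%N -> p a.+2 <= p b.+2.
  elim: b => [|b IH]; first by case: a.
  move=> /andP[]; rewrite leq_eqVlt => /orP[/eqP->//|ab] bm.
  by apply: le_trans (IH _) _; [lia|apply: hpmono; lia].
have p2 i : (i <= m)%N -> 2 < p i.+2.
  by move=> im; apply: lt_le_trans hp2 (mono 0%N _ _).
have psmall i : (i < j)%N -> p i.+2 < (d%:R + 1) / 2.
  case: j hpj jm {hj hjmax} => [//|j] hpj jm ij.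
  by apply: le_lt_trans hpj; apply: mono; lia.
have plarge i : (j <= i <= m)%N -> (j < m)%N -> (d%:R + 1) / 2 <= p i.+2.
  move=> /andP[ji im] jm'.
  apply: (@le_trans _ _ (p j.+2)); last by apply: mono; rewrite ji.
  rewrite leNgt; apply/negP => /hjmax; rewrite ltnn => H.
  by suff : false by []; apply: H; lia.
have psum : \sum_(i < m.+2) (p i.+1)^-1 = 1.
  by rewrite -hpsum big_add1/= big_mkord.
have hp1' : 1 < p 1%N < 2.
  case/andP: hp1 => p1l ->; rewrite andbT; apply: lt_trans p1l.
  have : (9 : R) <= d%:R by rewrite (ler_nat _ 9); lia.
  by move=> d9; rewrite ltr_pdivlMr; lra.
have jsum : \sum_(2 <= i < j.+2) d%:R / p i = \sum_(i < j) d%:R / p i.+2.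
  by rewrite big_add1 big_add1 big_mkord.
split=> [|[jE] h].
  have [C C0 CP] := Tsim_bound_corners hd m0 jm hp1 p2 psmall plarge psum.
  exists C => // lam f lam0; rewrite jsum.
  by rewrite (prod_input_exp p m.+1 (fun q i => lpnorm q (f i))); exact: CP.
have jmE : j = m by lia.
rewrite jmE in psmall.
have [C C0 CP] := Tsim_bound_improving hd m0 hp1' p2 psmall psum h.
exists C => // lam f lam0.
by rewrite (prod_input_exp p m.+1 (fun q i => lpnorm q (f i))); exact: CP.
Qed.
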